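(* Let $n\ge4$ be even, $p\ge n+1$ an integer, $c_1$ a positive integer, $a_k=pc_k$, $c_{k+1}=p^2c_k$, and let $T$, $I^{(k)}_i$, $b_{k,i}$ and the measures $\lambda_j$ be as in the context. Then for any distinct $i,j\in\{3,5,\dots,n-1,n\}$, $$\liminf_{k\to\infty}\log_{\lambda_j(I_i^{(k)})}\bigl(\lambda_i(I_i^{(k)})\bigr)\ \le\ \dim_H(\lambda_i,d_{\lambda_j})\ \le\ \liminf_{k\to\infty}\log_{\lambda_j(I_i^{(k)})} b_{k,i}^{-1}.$$
   Context: $\pi$ is the permutation of $\{1,\dots,n\}$ with top row $1,2,\dots,n$ and bottom row $n,3,2,5,4,\dots,n-1,n-2,1$. Right Rauzy induction: step ''0'' when the rightmost domain (top) interval is longer, ''1'' when the rightmost image (bottom) interval is longer; induce on the interval with the shorter length removed from the right. For $a,c>0$, $\dot\gamma_{m,a}=1^{n-1-m}0^a10^2$, $\gamma_{a,c}=0\,\dot\gamma_{n-2,a}\cdots\dot\gamma_{2,a}\,1^{c(n-1)}$; its transition matrix $\Theta_{a,c}$ (old lengths $=\Theta_{a,c}\cdot$new lengths) has row $1=(1,c,\dots,c)$, row $n=(1,c+1,\dots,c+1)$, and for $1\le i\le(n-2)/2$: row $2i$ has $0$ in column 1, $2$ in columns $2i,2i+1$, $1$ in the other columns among $2,\dots,n$; row $2i+1$ has $a$ in column $2i$, $a+1$ in column $2i+1$, $0$ elsewhere. $\Theta_k=\Theta_{a_k,c_k}$. $T$ is an IET of $[0,1)$ with permutation $\pi$ whose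 right Rauzy induction path is $\gamma_{a_1,c_1}\gamma_{a_2,c_2}\cdots$. For $k\ge0$, $I^{(k)}$ is the interval (with left endpoint $0$) on which the induced (first return) map of $T$ lives after the first $k$ blocks $\gamma_{a_1,c_1}\cdots\gamma_{a_k,c_k}$, and $I^{(k)}_1,\dots,I^{(k)}_n$ are its exchanged subintervals ($I^{(0)}=[0,1)$, $I^{(0)}_i=X_i$ the initial subintervals); length vectors satisfy $\ell^{(k-1)}=\Theta_k\ell^{(k)}$. $b_{k,i}=|\Theta_1\cdots\Theta_ke_i|$, the sum of entries, which is the first return time of $I^{(k)}_i$ to $I^{(k)}$. For $v\ge0$, $\overline v=v/|v|$. For $j\in\{1,\dots,n\}$, $\lambda_j$ denotes the $T$-invariant Borel probability measure on $[0,1)$ such that for every $k\ge0$ the vector $(\lambda_j(I^{(k)}_1),\dots,\lambda_j(I^{(k)}_n))$ is a positive multiple of $\lim_{m\to\infty}\overline{\Theta_{k+1}\cdots\Theta_me_j}$ (these limits exist). For a non-atomic probability measure $\nu$ on $[0,1)$, $d_\nu(x,y)=\nu([\min(x,y),\max(x,y)))$; for a measure $\mu$, $\dim_H(\mu,d)$ is the infimum of the Hausdorff dimensions, with respect to $d$, of Borel sets $A$ with $\mu(A)=1$. *)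

(* Defs.v *)
From HB Require Import structures.
From mathcomp Require Import all_boot all_order all_algebra.
From mathcomp Require Import all_classical all_reals all_analysis.

Set Implicit Arguments.
Unset Strict Implicit.
Unset Printing Implicit Defensive.

Import Order.TTheory GRing.Theory Num.Theory.
Import numFieldNormedType.Exports.

Local Open Scope classical_set_scope.
Local Open Scope ring_scope.

(* A (labelled) permutation is a pair (top, bottom) of orderings of 1..n.   *)

Definition pi_top (n : nat) : seq nat := iota 1 n.
Definition pi_bot (n : nat) : seq nat :=
  n :: flatten [seq [:: i.*2.+1; i.*2] | i <- iota 1 (n.-2)./2] ++ [:: 1%N].

(* Rauzy words: false = step "0", true = step "1". *)
Definition gamma_dot (n m a : nat) : seq bool :=
  nseq (n.-1 - m) true ++ nseq a false ++ [:: true; false; false].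

Definition gamma (n a c : nat) : seq bool :=
  false :: flatten [seq gamma_dot n (n - 2 - r.*2) a | r <- iota 0 (n.-2)./2]
        ++ nseq (c * n.-1) true.

Definition cseq (p c1 k : nat) : nat := c1 * p ^ (2 * k.-1).
Definition aseq (p c1 k : nat) : nat := p * cseq p c1 k.

Definition blocks_upto (n p c1 K : nat) : seq bool :=
  flatten [seq gamma n (aseq p c1 k) (cseq p c1 k) | k <- iota 1 K].

(* Transition matrices, as nat-valued functions of (row, column) in 1..n.   *)
Definition Theta (n a c : nat) (r col : nat) : nat :=
  if r == 1%N then (if col == 1%N then 1%N else c)
  else if r == n then (if col == 1%N then 1%N else c.+1)
  else if ~~ odd r then
    (if col == 1%N then 0%N else if (col == r) || (col == r.+1) then 2%N else 1%N)
  else (if col == r.-1 then a else if col == r then a.+1 else 0%N).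

Definition mulM (n : nat) (A B : nat -> nat -> nat) (r col : nat) : nat :=
  (\sum_(1 <= l < n.+1) A r l * B l col)%N.

Definition idM (r col : nat) : nat := (r == col : nat).

Fixpoint ThetaProd (n p c1 k d : nat) : nat -> nat -> nat :=
  match d with
  | 0 => idM
  | d'.+1 => mulM n (ThetaProd n p c1 k d')
               (Theta n (aseq p c1 (k + d'.+1)) (cseq p c1 (k + d'.+1)))
  end.

Definition bki (n p c1 k i : nat) : nat :=
  (\sum_(1 <= r < n.+1) ThetaProd n p c1 0 k r i)%N.

Section IET.
Variable R : realType.

(* state = (top row, bottom row, length vector indexed by letters) *)
Definition iet_state := (seq nat * seq nat * (nat -> R))%type.

Definition start (s : seq nat) (l : nat -> R) (a : nat) : R :=
  \sum_(b <- take (index a s) s) l b.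

Definition iet (t b : seq nat) (l : nat -> R) (x : R) : R :=
  x + \sum_(a <- t) (if (start t l a <= x) && (x < start t l a + l a)
                     then start b l a - start t l a else 0).

Definition upd (l : nat -> R) (a : nat) (v : R) : nat -> R :=
  fun x => if x == a then v else l x.

Definition insert_after (x y : nat) (s : seq nat) : seq nat :=
  take (index x s).+1 s ++ y :: drop (index x s).+1 s.

Definition drop_last (s : seq nat) : seq nat := take (size s).-1 s.

Definition rauzy_step (st : iet_state) : option (bool * iet_state) :=
  let: (t, b, l) := st in
  let al := last 0%N t in
  let be := last 0%N b in
  if l be < l al then
    Some (false, (t, insert_after al be (drop_last b), upd l al (l al - l be)))
  else if l al < l be then
    Some (true, (insert_after be al (drop_last t), b, upd l be (l be - l al)))
  else None.

Fixpoint rauzy_iter (st : iet_state) (N : nat) : option (seq bool * iet_state) :=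
  match N with
  | 0 => Some ([::], st)
  | N'.+1 =>
    match rauzy_iter st N' with
    | None => None
    | Some (w, st') =>
      match rauzy_step st' with
      | None => None
      | Some (e, st'') => Some (rcons w e, st'')
      end
    end
  end.

Definition stage (st : iet_state) (N : nat) : iet_state :=
  if rauzy_iter st N is Some (_, st') then st' else st.

(* the right Rauzy induction path of st is the infinite word w_1 w_2 ... ,
   given through its prefixes P K = w_1 ... w_K *)
Definition has_path (st : iet_state) (P : nat -> seq bool) : Prop :=
  forall K, exists st', rauzy_iter st (size (P K)) = Some (P K, st').

Definition sub_interval (st : iet_state) (a : nat) : set R :=
  let: (t, _, l) := st in
  [set x | start t l a <= x < start t l a + l a].

End IET.

Definition T_state {R : realType} (n : nat) (ell : nat -> R) : iet_state R :=
  (pi_top n, pi_bot n, ell).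

Definition T_map {R : realType} (n : nat) (ell : nat -> R) : R -> R :=
  iet (pi_top n) (pi_bot n) ell.

Definition Iki {R : realType} (n p c1 : nat) (ell : nat -> R) (k i : nat) : set R :=
  sub_interval (stage (T_state n ell) (size (blocks_upto n p c1 k))) i.

Definition is_lambda {R : realType} (n p c1 : nat) (ell : nat -> R) (j : nat)
    (lam : probability R R) : Prop :=
  [/\ lam `[0%R, 1%R[%classic = 1%E,
      (forall A : set R, measurable A -> lam (T_map n ell @^-1` A) = lam A) &
      forall k : nat, exists2 t : R, 0 < t &
        forall r, (1 <= r <= n)%N ->
          (fun m : nat => (ThetaProd n p c1 k (m - k) r j)%:R /
                          (\sum_(1 <= q < n.+1) ThetaProd n p c1 k (m - k) q j)%:R)
            @ \oo --> fine (lam (Iki n p c1 ell k r)) / t].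

Section Hausdorff.
Variable R : realType.
Local Open Scope ereal_scope.

Definition d_meas (nu : {measure set R -> \bar R}) (x y : R) : R :=
  fine (nu `[Order.min x y, Order.max x y[%classic).

(* diameter w.r.t. d (sup over the empty set is -oo) *)
Definition diam (d : R -> R -> R) (U : set R) : \bar R :=
  ereal_sup [set (d z.1 z.2)%:E | z in U `*` U].

Definition hcontrib (d : R -> R -> R) (s : R) (U : set R) : \bar R :=
  if `[< U = set0 >] then 0 else ((fine (diam d U)) `^ s)%:E.

Definition hausdorff_delta (d : R -> R -> R) (s delta : R) (A : set R) : \bar R :=
  ereal_inf [set \sum_(0 <= k <oo) hcontrib d s (F k) |
             F in [set F : nat -> set R |
                    A `<=` \bigcup_k F k /\ forall k, diam d (F k) <= delta%:E]].

Definition hausdorff_measure (d : R -> R -> R) (s : R) (A : set R) : \bar R :=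
  ereal_sup [set hausdorff_delta d s delta A | delta in [set delta : R | (0 < delta)%R]].

Definition hausdorff_dim (d : R -> R -> R) (A : set R) : \bar R :=
  ereal_inf [set s%:E | s in [set s : R | (0 <= s)%R /\ hausdorff_measure d s A = 0]].

Definition hausdorff_dim_meas (mu : {measure set R -> \bar R}) (d : R -> R -> R) : \bar R :=
  ereal_inf [set hausdorff_dim d A |
             A in [set A : set R | measurable A /\ A `<=` `[0%R, 1%R[%classic /\ mu A = 1]].

End Hausdorff.

Definition admissible (n i : nat) : bool :=
  ((3 <= i <= n.-1)%N && odd i) || (i == n).

(* Main.v *)
Require Import Defs.
From HB Require Import structures.
From mathcomp Require Import all_boot all_order all_algebra.
From mathcomp Require Import all_classical all_reals all_analysis.
From mathcomp Require Import lra ring zify.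
Import Order.TTheory GRing.Theory Num.Theory.
Import numFieldNormedType.Exports.
Local Open Scope classical_set_scope.
Local Open Scope ring_scope.

Set Implicit Arguments.
Unset Strict Implicit.
Unset Printing Implicit Defensive.

(* Both liminfs and the dimension equal 1. Rauzy induction cuts [0, 1) into
   floors T^h I^(k)_r, 0 <= h < b_{k,r}, and every T-invariant probability
   measure gives the floors over I^(k)_r the same mass v_{k,r}, with
   v_k = Theta_{k+1} v_{k+1} and sum_r b_{k,r} v_{k,r} = 1. Since
   log a_k and log c_k are both 2 k log p + O(1), since row n of Theta is
   positive, and since a product of three consecutive Theta's is positive, one gets
   log b_{k,r} = k^2 log p + O(k) and -log v_{k,r} = k^2 log p + O(k), uniformly
   in r and whatever the invariant measure. Hence the quotients of logarithms
   tend to 1, and comparing an interval with the floors it contains shows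
   lambda_i(J) <= C_s lambda_j(J)^s for all intervals J and all s < 1, so the mass
   distribution principle bounds the dimension below by 1. It is at most 1 because
   ([0, 1), d_nu) is isometric to a subset of [0, 1], by the distribution function
   of nu. *)

(** * One step of Rauzy induction *)

(** The hypothesis on the path gives words only, no lengths. [height_word] therefore runs the dual
    cocycle on the word alone; the pairing sum_a h_a v_a of heights with masses is preserved by
    every step, and testing it on unit height vectors turns the effect of a block on heights into
    v_k = Theta_{k+1} v_{k+1}. A measure enters only through G(x) = mu [0, x), so that invariance
    becomes one translation identity per letter, and floors are never named as iterates of T: a list
    of letters records the pieces that cut [0, 1) from left to right. Comparing two measures needs
    the same list for both, hence the list is built before the measure is chosen. The exponent k^2
    comes, up to a shift of the level, from p^(0 + 2 + ... + 2(k-1)) <= b <= const^k p^(1 + 3 + ...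
    + (2k-1)): the products of the c's and of the a's differ by the factor p^k only, and quotients
    of logarithms do not see it. *)

Section Starts.
Variable R : realType.
Implicit Types (l : nat -> R) (s A B X Y W : seq nat) (a w z : nat) (G : R -> R).

Lemma start_cat A B l a : a \notin A -> start (A ++ a :: B) l a = \sum_(b <- A) l b.
Proof.
move=> aA; rewrite /start index_cat (negPf aA) /= eqxx addn0.
by rewrite take_size_cat.
Qed.

Lemma mem_split s a : a \in s -> exists A B, s = A ++ a :: B /\ a \notin A.
Proof.
move=> sa; exists (take (index a s) s), (drop (index a s).+1 s); split.
  by rewrite -[X in X :: _](nth_index 0%N sa) -drop_nth ?cat_take_drop // index_mem.
by rewrite in_take ?ltnn // index_size.
Qed.

Lemma sum_upd_notin s l w x :
  w \notin s -> \sum_(b <- s) upd l w x b = \sum_(b <- s) l b.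
Proof.
move=> ws; apply: eq_big_seq => b bs; rewrite /upd; case: eqP => // E.
by move: ws; rewrite -E bs.
Qed.

Lemma start_upd_last X w l x a : uniq (rcons X w) -> a \in rcons X w ->
  start (rcons X w) (upd l w x) a = start (rcons X w) l a.
Proof.
rewrite rcons_uniq => /andP[wX _]; rewrite mem_rcons inE => /orP[/eqP->|aX].
  by rewrite -cats1 !start_cat // sum_upd_notin.
have [A [B [E aA]]] := mem_split aX; subst X.
rewrite rcons_cat rcons_cons !start_cat // sum_upd_notin //.
by move: wX; rewrite mem_cat negb_or => /andP[].
Qed.

(** Shortening [w] by [l z] frees exactly the room that [z] takes behind it, so no other letter
    moves. *)
Lemma start_insert A B w z l a : uniq (A ++ w :: z :: B) -> a \in A ++ w :: z :: B ->
  a != z ->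
  start (A ++ w :: z :: B) (upd l w (l w - l z)) a = start (rcons (A ++ w :: B) z) l a.
Proof.
set l' := upd _ _ _.
rewrite cat_uniq /= negb_or !inE !negb_or => /and3P[_ /and3P[wA zA _]].
move=> /andP[/andP[wz wB] /andP[zB uB]].
rewrite rcons_cat rcons_cons mem_cat !inE => /or3P[aA|/eqP->|].
- have [A1 [A2 [E aA1]]] := mem_split aA; subst A.
  rewrite -!catA /= !start_cat // sum_upd_notin //.
  by move: wA; rewrite mem_cat negb_or => /andP[].
- by rewrite !start_cat // sum_upd_notin.
- case/orP=> [->//|aB] az.
  have [A1 [A2 [E aA1]]] := mem_split aB; subst B.
  have wA1 : w \notin A1 by move: wB; rewrite mem_cat negb_or => /andP[].
  have [aA|aA] := boolP (a \in A).
    have [A3 [A4 [E aA3]]] := mem_split aA; subst A.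
    rewrite -!catA /= !start_cat // sum_upd_notin //.
    by move: wA; rewrite mem_cat negb_or => /andP[].
  have aw : a != w by apply: contraNneq wB => <-.
  rewrite -[A ++ w :: z :: _]/(A ++ [:: w; z] ++ _) -[A ++ w :: rcons _ _]/(A ++ [:: w] ++ _).
  rewrite rcons_cat rcons_cons.
  rewrite [in LHS]catA [in LHS]catA [in RHS]catA [in RHS]catA !start_cat ?mem_cat ?inE ?negb_or ?aA ?aw ?az //.
  rewrite !big_cat /= !big_cons !big_nil !sum_upd_notin //.
  rewrite /l' /upd eqxx eq_sym (negPf wz); lra.
Qed.

Lemma start_insert_new A B w z l : uniq (A ++ w :: z :: B) ->
  start (A ++ w :: z :: B) (upd l w (l w - l z)) z
  = start (rcons (A ++ w :: B) z) l w + l w - l z.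
Proof.
rewrite cat_uniq /= negb_or !inE !negb_or => /and3P[_ /and3P[wA zA _]].
move=> /andP[/andP[wz wB] /andP[zB uB]].
rewrite rcons_cat rcons_cons start_cat //.
rewrite -[A ++ w :: z :: _]/(A ++ [:: w] ++ _) catA start_cat; last first.
  by rewrite mem_cat inE negb_or zA eq_sym.
by rewrite big_cat big_seq1 /= sum_upd_notin // /upd eqxx addrA.
Qed.

(* [G] plays the distribution function of a measure: translating [x, x + L) to
   [y, y + L) preserves the measure of subintervals. *)
Definition translates G (x y L : R) :=
  forall u, 0 <= u <= L -> G (x + u) - G x = G (y + u) - G y.

Lemma translates_sym G x y L : translates G x y L -> translates G y x L.
Proof. by move=> H u /H ->. Qed.

Lemma translates_trans G x y (z : R) L :
  translates G x y L -> translates G y z L -> translates G x z L.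
Proof. by move=> H1 H2 u uL; rewrite H1 // H2. Qed.

Lemma translates_sub G x y L d L' : translates G x y L -> 0 <= d -> d + L' <= L ->
  translates G (x + d) (y + d) L'.
Proof.
move=> H d0 dL u uL; have := H (d + u); have := H d; rewrite !addrA.
by move=> H1 H2; have := H1 ltac:(lra); have := H2 ltac:(lra); lra.
Qed.

Lemma translates_le G x y L L' : translates G x y L -> L' <= L -> translates G x y L'.
Proof. by move=> H LL u /andP[u0 uL]; apply: H; rewrite u0 (le_trans uL). Qed.

Definition invariant_under X Y l G :=
  forall a, a \in X -> translates G (start X l a) (start Y l a) (l a).

Definition piece_mass X l G a := G (start X l a + l a) - G (start X l a).

(** A substitute for Rokhlin towers: from [x] on, the line is cut into pieces labelled by [W], and a
    piece labelled [a] is only known to carry the same G-increments as the top interval of [a]. *)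
Fixpoint tiles X l G x W : Prop :=
  if W is a :: W' then
    [/\ a \in X, translates G x (start X l a) (l a) & tiles X l G (x + l a) W']
  else True.

(** The tail that the winner [w] loses is a translate of the interval of [z], so an old copy of [w]
    is a shorter copy of [w] followed by a copy of [z]. *)
Definition refine w z W : seq nat :=
  flatten [seq if a == w then [:: w; z] else [:: a] | a <- W].

Lemma invariant_under_sym X Y l G : perm_eq X Y ->
  invariant_under X Y l G -> invariant_under Y X l G.
Proof. by move=> XY H a aY; apply: translates_sym; apply: H; rewrite (perm_mem XY). Qed.

Lemma tiles_swap X Y l G x W : perm_eq X Y -> invariant_under X Y l G ->
  tiles X l G x W -> tiles Y l G x W.
Proof.
move=> XY inv; elim: W x => //= a W IH x [aX H /IH ?]; split => //.
  by rewrite -(perm_mem XY).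
by apply: translates_trans H _; exact: inv.
Qed.

Lemma piece_mass_swap X Y l G a : 0 <= l a -> invariant_under X Y l G -> a \in X ->
  piece_mass X l G a = piece_mass Y l G a.
Proof. by move=> la inv aX; rewrite /piece_mass inv // lexx la. Qed.

Lemma sum_last_start X w l : uniq (rcons X w) ->
  \sum_(b <- rcons X w) l b = start (rcons X w) l w + l w.
Proof.
rewrite rcons_uniq => /andP[wX _].
by rewrite -{2}cats1 start_cat // -cats1 big_cat big_seq1.
Qed.

Section Step.
Variables (X1 A B : seq nat) (w z : nat) (l : nat -> R).
(** [X] is the row that ends in the winner, [Y] the row that ends in the loser. Leaving open which
    of them is the top row lets the two types of step share one argument. *)
Let X := rcons X1 w.
Let Y := rcons (A ++ w :: B) z.
Let Y' := A ++ w :: z :: B.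
Let l' := upd l w (l w - l z).
Hypothesis (uX : uniq X) (XY : perm_eq X Y) (lzw : l z < l w).
Hypothesis (lpos : forall a, a \in X -> 0 < l a).

Lemma step_perm : perm_eq X Y'.
Proof.
apply: perm_trans XY _; rewrite /Y /Y' rcons_cat rcons_cons perm_cat2l perm_cons.
by rewrite -cats1 -(cat1s z) perm_catC.
Qed.

Let uY' : uniq Y'. Proof. by rewrite -(perm_uniq step_perm). Qed.
Let uY : uniq Y. Proof. by rewrite -(perm_uniq XY). Qed.
Let zX : z \in X. Proof. by rewrite (perm_mem XY) mem_rcons inE eqxx. Qed.
Let wX : w \in X. Proof. by rewrite mem_rcons inE eqxx. Qed.
Let zw : z != w. Proof. by apply: contraTneq lzw => ->; rewrite ltxx. Qed.
Let lz0 : 0 < l z. Proof. exact: lpos. Qed.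

Lemma step_pos a : a \in X -> 0 < l' a.
Proof. by move=> aX; rewrite /l' /upd; case: eqP => _; [rewrite subr_gt0|exact: lpos]. Qed.

Let ends : start X l w + l w = start Y l z + l z.
Proof. by rewrite -!sum_last_start //; exact: perm_big. Qed.

Let l'z : l' z = l z. Proof. by rewrite /l' /upd (negPf zw). Qed.
Let l'w : l' w = l w - l z. Proof. by rewrite /l' /upd eqxx. Qed.

Let l'_le a : l' a <= l a.
Proof. by rewrite /l' /upd; case: eqP => [->|//]; rewrite gerBl; exact: ltW. Qed.

Section G.
Variable G : R -> R.
Hypothesis inv : invariant_under X Y l G.

(** Both rows have the same total length, so the interval of [z] in [Y] is the tail of the interval
    of [w] in [X]; the exchange links it to the interval of [z] in [X]. *)
Let tailz : translates G (start X l w + (l w - l z)) (start X l z) (l z).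
Proof.
have -> : start X l w + (l w - l z) = start Y l z by move: ends; lra.
by apply: translates_sym; exact: inv.
Qed.

Lemma step_invariant : invariant_under X Y' l' G.
Proof.
move=> a aX; rewrite start_upd_last //.
have [->|az] := eqVneq a z.
  rewrite start_insert_new // l'z -addrA; apply: translates_sym.
  apply: translates_trans tailz.
  by apply: translates_sub (translates_sym (inv wX)) _ _; rewrite ?subr_ge0 ?subrK ?lexx ?ltW.
rewrite start_insert -?(perm_mem step_perm) //.
by apply: translates_le (inv aX) _; exact: l'_le.
Qed.

Lemma step_piece_mass a : a \in X ->
  piece_mass X l' G a = piece_mass X l G a - (if a == w then piece_mass X l G z else 0).
Proof.
move=> aX; rewrite /piece_mass start_upd_last //; case: eqP => [->|/eqP aw].
  rewrite l'w; have := tailz (u := l z); rewrite lexx (ltW lz0) => /(_ isT).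
  have -> : start X l w + (l w - l z) + l z = start X l w + l w by ring.
  lra.
by rewrite /l' /upd (negPf aw) subr0.
Qed.

Lemma step_tiles x W : tiles X l G x W -> tiles X l' G x (refine w z W).
Proof.
elim: W x => //= a W IH x [aX H /IH HW]; rewrite /refine /=.
case: eqP => [E|/eqP aw] /=; split => //; rewrite ?start_upd_last //.
- by rewrite E in H; apply: translates_le H _; exact: l'_le.
- split=> //.
    rewrite l'w l'z.
    apply: translates_trans tailz; rewrite E in H.
    by apply: translates_sub H _ _; rewrite ?subr_ge0 ?subrK ?lexx ?ltW.
  by rewrite l'w l'z -addrA subrK; rewrite E in HW.
- exact: translates_le H _.
- by have -> : l' a = l a by rewrite /l' /upd (negPf aw).
Qed.

End G.

Lemma step_sum W : \sum_(a <- refine w z W) l' a = \sum_(a <- W) l a.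
Proof.
elim: W => [|a W IH]; first by rewrite /refine /= !big_nil.
rewrite /refine /= big_cat /= -/(refine _ _ _) IH big_cons; congr (_ + _).
case: eqP => [->|/eqP aw]; first by rewrite big_cons big_seq1 l'w l'z subrK.
by rewrite big_seq1 /l' /upd (negPf aw).
Qed.

(** Only two terms change: (h_z + h_w) v_z + h_w (v_w - v_z) = h_z v_z + h_w v_w. *)
Lemma step_dual (h v v' : nat -> R) :
  (forall a, a \in X -> v' a = v a - (if a == w then v z else 0)) ->
  \sum_(a <- X) upd h z (h z + h w) a * v' a = \sum_(a <- X) h a * v a.
Proof.
move=> Hv; have wr : w \in rem z X by rewrite mem_rem_uniq // inE eq_sym zw.
have P : perm_eq X (z :: w :: rem w (rem z X)).
  by apply: perm_trans (perm_to_rem zX) _; rewrite perm_cons perm_to_rem.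
rewrite !(perm_big _ P) !big_cons /=.
have -> : \sum_(a <- rem w (rem z X)) upd h z (h z + h w) a * v' a
        = \sum_(a <- rem w (rem z X)) h a * v a.
  apply: eq_big_seq => a; rewrite mem_rem_uniq ?rem_uniq // inE mem_rem_uniq // inE.
  by case/and3P=> aw az aX; rewrite Hv // (negPf aw) subr0 /upd (negPf az).
rewrite !Hv // eqxx (negPf zw) subr0 /upd eqxx (eq_sym w) (negPf zw); ring.
Qed.

End Step.
End Starts.


(** * Lengths, masses and heights along a Rauzy word *)

Section Evolution.
Variable R : realType.
Implicit Types (l h : nat -> R) (t b s A B W : seq nat) (a w z : nat) (G : R -> R).
Implicit Types (st : iet_state R) (u : seq bool).

Lemma insert_after_cat A B w z : w \notin A ->
  insert_after w z (A ++ w :: B) = A ++ w :: z :: B.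
Proof.
move=> wA; rewrite /insert_after index_cat (negPf wA) /= eqxx addn0.
rewrite -!(cat_rcons w) take_size_cat ?size_rcons // drop_size_cat ?size_rcons //.
Qed.

Lemma drop_last_rcons s a : drop_last (rcons s a) = s.
Proof. by rewrite /drop_last size_rcons -cats1 take_size_cat. Qed.

Definition wf t b l := [/\ uniq t, perm_eq t b & forall a, a \in t -> 0 < l a].

(* The dual (return time) cocycle along a Rauzy word: the loser's tower is
   stacked on top of the winner's. *)
Definition height_step st (e : bool) : iet_state R :=
  let: (t, b, h) := st in
  let al := last 0%N t in
  let be := last 0%N b in
  if e then (insert_after be al (drop_last t), b, upd h al (h al + h be))
  else (t, insert_after al be (drop_last b), upd h be (h be + h al)).

Definition height_word st u := foldl height_step st u.

(** The map [f] on tilings is quantified before [G]: one tiling then serves all invariant measures.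
    Quantifying over all [h] makes the last clause the duality between the height cocycle and the
    mass cocycle. *)
Definition evolves st u st' : Prop :=
  let: (t, b, l) := st in
  let: (t', b', l') := st' in
  [/\ wf t' b' l', perm_eq t t',
      forall h, (height_word (t, b, h) u).1 = (t', b') &
      exists f : seq nat -> seq nat,
        (forall W, \sum_(a <- f W) l' a = \sum_(a <- W) l a) /\
        forall G, invariant_under t b l G ->
          [/\ invariant_under t' b' l' G,
              forall x W, tiles t l G x W -> tiles t' l' G x (f W) &
              forall h, \sum_(a <- t) (height_word (t, b, h) u).2 a * piece_mass t' l' G a
                      = \sum_(a <- t) h a * piece_mass t l G a]].

Lemma rcons_split t b : perm_eq t b -> last 0%N t != last 0%N b ->
  exists t1 A B, [/\ t = rcons t1 (last 0%N t),
    b = rcons (A ++ last 0%N t :: B) (last 0%N b) & last 0%N t \notin A].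
Proof.
case/lastP: t => [|t1 al]; case/lastP: b => [|b1 be] //.
- by move/perm_size; rewrite size_rcons.
- by move/perm_size; rewrite size_rcons.
rewrite !last_rcons => P alb.
have : al \in rcons b1 be by rewrite -(perm_mem P) mem_rcons inE eqxx.
rewrite mem_rcons inE (negPf alb) /= => /mem_split[A [B [E aA]]].
by exists t1, A, B; rewrite E.
Qed.

Lemma rauzy_step_evolves t b l e st' : wf t b l ->
  rauzy_step (t, b, l) = Some (e, st') -> evolves (t, b, l) [:: e] st'.
Proof.
move=> [ut tb lpos]; rewrite /rauzy_step.
case: ifP => [lt1|_]; last case: ifP => [lt1|//].
- have ne : last 0%N t != last 0%N b by apply: contraTneq lt1 => ->; rewrite ltxx.
  have [t1 [A [B [tE bE nA]]]] := rcons_split tb ne.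
  move: (last 0%N t) (last 0%N b) ne tE bE nA lt1 => w z ne tE bE nA lt1; subst t b.
  rewrite drop_last_rcons insert_after_cat // => -[<- <-].
  have P := step_perm tb.
  split.
  + split=> // a at_; exact: step_pos lt1 lpos _ at_.
  + exact: perm_refl.
  + by move=> h /=; rewrite !last_rcons drop_last_rcons insert_after_cat.
  exists (refine w z); split; first by move=> W; exact: step_sum.
  move=> G inv; split.
  + exact: step_invariant.
  + by move=> x W; exact: (step_tiles ut tb lt1 lpos inv).
  move=> h /=; rewrite !last_rcons /=.
  by apply: (step_dual ut tb lt1) => a at_; rewrite (step_piece_mass ut tb lpos).
(* The winner now ends the bottom row, so [b] plays the row [X] of the step lemmas; tilings and
   masses are carried between the rows by [tiles_swap] and [piece_mass_swap]. *)
- have ne : last 0%N b != last 0%N t by apply: contraTneq lt1 => ->; rewrite ltxx.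
  have bt : perm_eq b t by rewrite perm_sym.
  have ub : uniq b by rewrite (perm_uniq bt).
  have bpos a : a \in b -> 0 < l a by rewrite (perm_mem bt); exact: lpos.
  have [b1 [A [B [bE tE nA]]]] := rcons_split bt ne.
  move: (last 0%N b) (last 0%N t) ne tE bE nA lt1 => w z ne tE bE nA lt1; subst t b.
  rewrite drop_last_rcons insert_after_cat // => -[<- <-].
  have P := step_perm bt.
  have P' : perm_eq (A ++ w :: z :: B) (rcons b1 w) by rewrite perm_sym.
  have pos' := step_pos lt1 bpos.
  split.
  + split=> //; first by rewrite (perm_uniq P').
    by move=> a; rewrite (perm_mem P'); exact: pos'.
  + by rewrite perm_sym; apply: perm_trans P' _.
  + by move=> h /=; rewrite !last_rcons drop_last_rcons insert_after_cat.
  exists (refine w z); split; first by move=> W; exact: step_sum.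
  move=> G inv.
  have inv' : invariant_under (rcons b1 w) (rcons (A ++ w :: B) z) l G
    by exact: invariant_under_sym.
  have inv'' := step_invariant ub bt lt1 bpos inv'.
  split.
  + exact: invariant_under_sym.
  + move=> x W /(tiles_swap tb inv) T.
    by apply: (tiles_swap P inv''); exact: (step_tiles ub bt lt1 bpos inv').
  move=> h /=; rewrite !last_rcons /=.
  rewrite !(perm_big _ tb) /=.
  under [RHS]eq_big_seq => a ab.
    rewrite -(piece_mass_swap _ inv') //; last exact/ltW/bpos. over.
  under [LHS]eq_big_seq => a ab.
    rewrite -(piece_mass_swap _ inv'') //; last exact/ltW/pos'. over.
  by apply: (step_dual ub bt lt1) => a at_; rewrite (step_piece_mass ub bt bpos).
Qed.

Lemma evolves_trans st u st' u' st'' :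
  evolves st u st' -> evolves st' u' st'' -> evolves st (u ++ u') st''.
Proof.
case: st => [[t b] l]; case: st' => [[t' b'] l']; case: st'' => [[t'' b''] l''].
move=> [_ P1 H1 [f1 [S1 I1]]] [wf2 P2 H2 [f2 [S2 I2]]].
have cat_hw h : height_word (t, b, h) (u ++ u')
    = height_word (t', b', (height_word (t, b, h) u).2) u'.
  by rewrite /height_word foldl_cat -/(height_word _ u) -(H1 h); case: height_word.
split=> //.
- exact: perm_trans P1 P2.
- by move=> h; rewrite cat_hw H2.
exists (f2 \o f1); split; first by move=> W /=; rewrite S2 S1.
move=> G /I1[/I2[inv2 T2 D2] T1 D1]; split=> //.
  by move=> x W /T1/T2.
by move=> h; rewrite cat_hw -D1 !(perm_big _ P1) D2.
Qed.

Lemma evolves_nil t b l : wf t b l -> evolves (t, b, l) [::] (t, b, l).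
Proof. by move=> ?; split=> //; exists id; split. Qed.

Lemma rauzy_iter_evolves t b l N u st' : wf t b l ->
  rauzy_iter (t, b, l) N = Some (u, st') -> evolves (t, b, l) u st'.
Proof.
move=> wf0; elim: N u st' => [|N IH] u st' /=; first by move=> [<- <-]; exact: evolves_nil.
case: (rauzy_iter _ N) IH => [[v st1]|//] /(_ _ _ erefl) ev1.
case E: rauzy_step => [[e st2]|//] [<- <-].
rewrite -cats1; apply: (evolves_trans ev1).
case: st1 ev1 E => [[t1 b1] l1] [wf1 _ _ _]; exact: rauzy_step_evolves.
Qed.

Lemma rauzy_iter_add st N M : rauzy_iter st (N + M) =
  if rauzy_iter st N is Some (u, st1) then
    if rauzy_iter st1 M is Some (u', st2) then Some (u ++ u', st2) else None
  else None.
Proof.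
elim: M => [|M IH]; first by rewrite addn0 /=; case: rauzy_iter => [[u s]|] //=; rewrite cats0.
rewrite addnS /= IH; case: (rauzy_iter st N) => [[u s]|] //.
case: (rauzy_iter s M) => [[u' s']|] //; case: rauzy_step => [[e s'']|] //.
by rewrite rcons_cat.
Qed.

End Evolution.

(** * The action of a block on return times *)

Section Gamma.
Variable R : realType.
Implicit Types (h : nat -> R) (t b A P Q D : seq nat) (x y z n a c m k r : nat).
Implicit Types (u : seq bool).

Lemma height_word_cat (st : iet_state R) u u' :
  height_word st (u ++ u') = height_word (height_word st u) u'.
Proof. exact: foldl_cat. Qed.

Lemma height_step_bot A Q w z b h : last 0%N b = w -> w \notin A ->
  height_step (rcons (A ++ w :: Q) z, b, h) true =
  (A ++ w :: z :: Q, b, upd h z (h z + h w)).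
Proof. by move=> bw wA; rewrite /= last_rcons drop_last_rcons bw insert_after_cat. Qed.

Lemma height_step_top A Q w z t h : last 0%N t = w -> w \notin A ->
  height_step (t, rcons (A ++ w :: Q) z, h) false =
  (t, A ++ w :: z :: Q, upd h z (h z + h w)).
Proof. by move=> tw wA; rewrite /= last_rcons drop_last_rcons tw insert_after_cat. Qed.

(** [x] wins every step, and each loser, taken from the right end, lands immediately behind [x];
    hence [Q] moves in front of [P] with its order kept. *)
Lemma height_word_rotate A x P Q b h : last 0%N b = x -> x \notin A -> x \notin Q ->
  uniq Q -> height_word (A ++ x :: P ++ Q, b, h) (nseq (size Q) true) =
  (A ++ x :: Q ++ P, b, fun z => if z \in Q then h z + h x else h z).
Proof.
move=> bx xA; elim/last_ind: Q P h => [|Q q IH] P h; first by rewrite cats0.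
rewrite rcons_uniq mem_rcons inE negb_or => /andP[xq xQ] /andP[qQ uQ].
rewrite size_rcons /=.
have -> : A ++ x :: P ++ rcons Q q = rcons (A ++ x :: P ++ Q) q.
  by rewrite -!cats1 -!catA /= -!catA.
rewrite last_rcons drop_last_rcons bx insert_after_cat //.
rewrite -[q :: P ++ Q]/((q :: P) ++ Q) IH // -cats1 -catA /=; congr (_, _, _).
apply/funext => z; rewrite mem_cat inE /upd (negPf xq).
have [->|zq] := eqVneq z q; first by rewrite (negPf qQ).
by rewrite orbF.
Qed.

(** The loser [x] already stands immediately behind the winner [y], so each step puts it back in
    place and only the height grows. *)
Lemma height_word_stack t D x y h a : last 0%N t = y -> y \notin D -> x != y ->
  height_word (t, D ++ [:: y; x], h) (nseq a false) =
  (t, D ++ [:: y; x], upd h x (h x + a%:R * h y)).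
Proof.
move=> ty yD xy; elim: a h => [|a IH] h.
  by congr (_, _, _); apply/funext => z; rewrite /upd mul0r addr0; case: eqP => [->|].
rewrite /= ty.
have -> : D ++ [:: y; x] = rcons (D ++ [:: y]) x by rewrite -cats1 -catA.
rewrite last_rcons drop_last_rcons insert_after_cat // IH -cats1 -catA.
congr (_, _, _); apply/funext => z; rewrite /upd eqxx [y == x]eq_sym (negPf xy).
by case: eqP => // _; rewrite -natr1; ring.
Qed.

(** The run of one factor [gamma_dot]: the rotation by [x] exposes [y] at the end of the top row,
    [y] wins [a] times over [x], one win of [x] restores the top row, and two wins of [n] bring [x],
    then [y], behind [n] in the bottom row. By then the height of [n] is h n + h x. *)
Lemma height_word_pair A x y Q D n h a : uniq (A ++ x :: y :: Q) -> n \in Q ->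
  last 0%N Q = n -> y \notin n :: D ->
  height_word (A ++ x :: y :: Q, n :: D ++ [:: y; x], h)
    (nseq (size Q) true ++ nseq a false ++ [:: true; false; false]) =
  (A ++ x :: y :: Q, [:: n, y, x & D], fun z =>
     if z == x then h x + a%:R * h y + (h n + h x)
     else if z == y then h y + (h x + a%:R * h y) + (h n + h x)
     else if z \in Q then h z + h x else h z).
Proof.
move=> uAQ nQ lQ ynD.
move: uAQ; rewrite cat_uniq /= !inE !negb_or => /and4P[_ /and3P[xA yA _]].
move=> /andP[xy xQ] /andP[yQ uQ].
have xn : x != n by apply: contraNneq xQ => ->.
have yn : y != n by apply: contraNneq yQ => ->.
have yx : y != x by rewrite eq_sym.
rewrite height_word_cat -[y :: Q]/([:: y] ++ Q) height_word_rotate //; last first.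
  by rewrite /= last_cat.
rewrite height_word_cat -!cat_cons height_word_stack //; last first.
  by rewrite !last_cat.
have E1 : A ++ (x :: Q) ++ [:: y] = rcons (A ++ x :: Q) y by rewrite -cats1 -catA.
rewrite [LHS]/(height_word (height_step (height_step (height_step _ _) _) _) [::]).
rewrite E1 height_step_bot //; last by rewrite last_cat.
have lt : last 0%N (A ++ [:: x, y & Q]) = n.
  by rewrite last_cat /=; case: (Q) nQ lQ.
have -> : (n :: D) ++ [:: y; x] = rcons ([::] ++ n :: D ++ [:: y]) x.
  by rewrite -cats1 /= -catA.
rewrite height_step_top //.
have -> : [::] ++ [:: n, x & D ++ [:: y]] = rcons ([::] ++ n :: x :: D) y by rewrite -cats1.
rewrite height_step_top //.
congr (_, _, _); apply/funext => z; rewrite /upd /=.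
rewrite !eqxx !(negPf xy, negPf yx, negPf xn, negPf yn) (eq_sym n x) (eq_sym n y).
rewrite !(negPf xn, negPf yn) nQ !(negPf xQ, negPf yQ).
have [->|zy] := eqVneq z y; first by rewrite (negPf yx); ring.
by case: eqP.
Qed.

Definition pairs i k : seq nat := flatten [seq [:: j.*2.+1; j.*2] | j <- iota i k].

Lemma pairs_last k : pairs 1 k.+1 = pairs 1 k ++ [:: k.*2.+3; k.*2.+2].
Proof. by rewrite /pairs -(addn1 k) iotaD map_cat flatten_cat /= add1n. Qed.

Lemma pi_botE m : pi_bot m.*2.+2 = m.*2.+2 :: pairs 1 m ++ [:: 1%N].
Proof. by rewrite /pi_bot /= doubleK. Qed.

Lemma mem_pairs i k z : (z \in pairs i k) = (i.*2 <= z < (i + k).*2)%N.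
Proof.
elim: k i => [|k IH] i; first by rewrite addn0; case: leqP => //=; lia.
rewrite /pairs /= !inE -/(pairs _ _) IH; lia.
Qed.

(** Closed form of the heights once the pairs (2i, 2i+1) with k < i <= m have been treated; pairs
    are treated from right to left, so k goes from m down to 0. The local [s] is the height that the
    letter n = 2m+2 has accumulated. *)
Definition stage_height m a h k z : R :=
  if z == 1%N then h 1%N + h m.*2.+2
  else if (z < k.*2.+2)%N || (m.*2.+2 < z)%N then h z
  else let s := h m.*2.+2 + \sum_(k.+1 <= i < m.+1) h i.*2 in
    if z == m.*2.+2 then s
    else if odd z then h z + (h z.-1 + a%:R * h z) + s
    else h z + a%:R * h z.+1 + s.

Lemma stage_height_step m a h k z : (k < m)%N ->
  let g := stage_height m a h k.+1 in
  stage_height m a h k z =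
     if z == k.*2.+2 then g k.*2.+2 + a%:R * g k.*2.+3 + (g m.*2.+2 + g k.*2.+2)
     else if z == k.*2.+3 then
       g k.*2.+3 + (g k.*2.+2 + a%:R * g k.*2.+3) + (g m.*2.+2 + g k.*2.+2)
     else if z \in iota k.*2.+4 (m - k.+1).*2.+1 then g z + g k.*2.+2 else g z.
Proof.
move=> km g.
have gx : g k.*2.+2 = h k.*2.+2 by rewrite /g /stage_height /= ifT //; lia.
have gy : g k.*2.+3 = h k.*2.+3 by rewrite /g /stage_height /= ifT //; lia.
have gn : g m.*2.+2 = h m.*2.+2 + \sum_(k.+2 <= i < m.+1) h i.*2.
  by rewrite /g /stage_height /= ifF ?eqxx //; lia.
rewrite gx gy gn mem_iota /g /stage_height big_ltn; last lia.
have [->|z1] := eqVneq z 1%N; first by [].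
have [->|zx] := eqVneq z k.*2.+2.
  rewrite ifF; last lia.
  rewrite ifF; last lia.
  by rewrite /= odd_double /= doubleS; ring.
have [->|zy] := eqVneq z k.*2.+3.
  rewrite ifF; last lia.
  rewrite ifF; last lia.
  by rewrite /= odd_double /= doubleS; ring.
have [zl|zl] := ltnP z k.*2.+2; rewrite /=.
  rewrite ifF; last lia.
  by rewrite ifT //; lia.
have [zn|zn] := ltnP m.*2.+2 z; rewrite /=.
  rewrite ifF; last lia.
  by rewrite orbT.
rewrite [in RHS]ifT; last lia.
rewrite [in RHS]ifF; last lia.
by rewrite doubleS; case: eqP => _; [ring|case: ifP => _; ring].
Qed.

Lemma height_word_pairs m a h r : (r <= m)%N ->
  height_word (iota 1 m.*2.+2, m.*2.+2 :: 1%N :: pairs 1 m, stage_height m a h m)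
    (flatten [seq gamma_dot m.*2.+2 (m.*2.+2 - 2 - r.*2) a | r <- iota 0 r]) =
  (iota 1 m.*2.+2, m.*2.+2 :: pairs (m - r).+1 r ++ 1%N :: pairs 1 (m - r),
   stage_height m a h (m - r)).
Proof.
elim: r => [|r IH] rm; first by rewrite subn0.
rewrite -[in iota 0 _](addn1 r) iotaD map_cat flatten_cat height_word_cat IH; last exact: ltnW.
rewrite [flatten _]/= cats0 /gamma_dot [m.*2.+2.-1]/=.
have -> : (m - r = (m - r.+1).+1)%N by lia.
have -> : (m.*2.+2 - 2 - r.*2 = (m - r.+1).*2.+2)%N by lia.
have : (m - r.+1 < m)%N by lia.
move: (m - r.+1)%N (subnKC rm) => k rk km.
have -> : (m.*2.+1 - k.*2.+2 = size (iota k.*2.+4 (m - k.+1).*2.+1))%N.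
  by rewrite size_iota; lia.
have E : iota 1 m.*2.+2 =
    iota 1 k.*2.+1 ++ k.*2.+2 :: k.*2.+3 :: iota k.*2.+4 (m - k.+1).*2.+1.
  have -> : (m.*2.+2 = k.*2.+1 + (m - k.+1).*2.+3)%N by lia.
  by rewrite iotaD add1n.
rewrite [in LHS]E pairs_last.
have E1 : m.*2.+2 :: pairs k.+2 r ++ 1%N :: pairs 1 k ++ [:: k.*2.+3; k.*2.+2]
    = m.*2.+2 :: (pairs k.+2 r ++ 1%N :: pairs 1 k) ++ [:: k.*2.+3; k.*2.+2].
  by rewrite -catA.
rewrite E1 height_word_pair.
- by rewrite -E; congr (_, _, _); apply/funext => z; rewrite -stage_height_step.
- by rewrite -E iota_uniq.
- by rewrite mem_iota; lia.
- by rewrite -[X in iota _ X]addn1 iotaD last_cat /=; lia.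
- rewrite inE mem_cat inE !mem_pairs; lia.
Qed.

Lemma height_word_rotates x Q b h c : last 0%N b = x -> x \notin Q -> uniq Q ->
  height_word (x :: Q, b, h) (nseq (c * size Q) true) =
  (x :: Q, b, fun z => if z \in Q then h z + c%:R * h x else h z).
Proof.
move=> bx xQ uQ; elim: c h => [|c IH] h.
  by rewrite mul0n; congr (_, _, _); apply/funext => z; rewrite mul0r addr0 if_same.
rewrite mulSn nseqD height_word_cat.
rewrite -[x :: Q in LHS]/([::] ++ x :: [::] ++ Q) height_word_rotate //= cats0 IH.
congr (_, _, _); apply/funext => z; rewrite (negPf xQ).
by case: (z \in Q) => //; rewrite -natr1; ring.
Qed.

Lemma sum_pairs m (F : nat -> R) : \sum_(1 <= l < m.*2.+3) F l =
  F 1%N + \sum_(1 <= i < m.+1) (F i.*2 + F i.*2.+1) + F m.*2.+2.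
Proof.
rewrite big_nat_recr //=; congr (_ + _); elim: m => [|m IH].
  by rewrite big_nat1 big_nil addr0.
by rewrite doubleS 2?big_nat_recr //= IH [in RHS]big_nat_recr //= doubleS; ring.
Qed.

(** The bridge between word and matrix: the row vector of heights is multiplied by [Theta] on the
    right, and the rows return to those of pi. This is pure combinatorics; no lengths are
    compared. *)
Lemma height_word_gamma m a c h : exists h', height_word
    (pi_top m.*2.+2, pi_bot m.*2.+2, h) (gamma m.*2.+2 a c) =
    (pi_top m.*2.+2, pi_bot m.*2.+2, h') /\
  forall z, (1 <= z <= m.*2.+2)%N ->
    h' z = \sum_(1 <= l < m.*2.+3) h l * (Theta m.*2.+2 a c l z)%:R.
Proof.
pose n := m.*2.+2.
exists (fun z => if z \in iota 2 n.-1 then stage_height m a h 0 z + c%:R * (h 1%N + h n)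
                 else stage_height m a h 0 z); split.
  have top_last : last 0%N (pi_top n) = n.
    by rewrite /pi_top -[X in iota _ X]addn1 iotaD last_cat.
  rewrite /gamma (doubleK m) -cat1s 2!height_word_cat pi_botE -/n.
  rewrite [height_word _ [:: false]]/(height_step _ false).
  have -> : n :: pairs 1 m ++ [:: 1%N] = rcons ([::] ++ n :: pairs 1 m) 1 by rewrite -cats1.
  rewrite last_rcons top_last drop_last_rcons insert_after_cat //=.
  have -> : upd h 1 (h 1%N + h n) = stage_height m a h m.
    apply/funext => z; rewrite /upd /stage_height; case: eqP => // _.
    case: ltngtP => //= ->; rewrite big_geq ?addr0 //.
  rewrite height_word_pairs // subnn.
  have -> : n :: rcons (pairs 1 m) 1%N = n :: pairs 1 m ++ [:: 1%N] by rewrite -cats1.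
  have := @height_word_rotates 1 (iota 2 n.-1) (n :: pairs 1 m ++ [:: 1%N])
    (stage_height m a h 0) c.
  rewrite size_iota; apply; rewrite ?iota_uniq ?mem_iota //.
  by rewrite -cat_cons last_cat.
move=> z /andP[z1 zn]; rewrite sum_pairs mem_iota.
have -> : (2 <= z < 2 + n.-1)%N = (z != 1)%N by rewrite /n /=; lia.
(* The rows 2i and 2i+1 together contribute h(2i) to every column z other than 1, and more than that
   only in their own columns 2i and 2i+1, that is, for i = z/2. *)
have -> : \sum_(1 <= i < m.+1) (h i.*2 * (Theta n a c i.*2 z)%:R
                              + h i.*2.+1 * (Theta n a c i.*2.+1 z)%:R)
  = \sum_(1 <= i < m.+1) (h i.*2 * (z != 1%N)%:R)
    + \sum_(1 <= i < m.+1 | i == z./2)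
        (if z == n then 0 else if odd z then (if z == 1%N then 0 else h z.-1 + h z * a.+1%:R)
         else h z + h z.+1 * a%:R).
  rewrite [X in _ + X]big_mkcond -big_split /=; apply: eq_big_nat => i /andP[i1 im].
  rewrite /Theta /n.
  rewrite (_ : (i.*2 == 1)%N = false); last lia.
  rewrite (_ : (i.*2 == m.*2.+2) = false); last lia.
  rewrite (_ : (i.*2.+1 == 1)%N = false); last lia.
  rewrite (_ : (i.*2.+1 == m.*2.+2) = false); last lia.
  rewrite /= odd_double /=.
  have [iz|iz] := eqVneq i z./2.
    have zE := odd_double_half z; rewrite -iz in zE.
    rewrite (_ : (z == 1%N) = false); last lia.
    rewrite (_ : (z == m.*2.+2) = false); last lia.
    case: (odd z) zE => <-.
      by rewrite add1n /= eqxx orbT ifF ?natr1 //=; [ring|lia].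
    by rewrite add0n /= eqxx /=; ring.
  rewrite (_ : (z == i.*2) = false); last by move: iz; lia.
  rewrite (_ : (z == i.*2.+1) = false); last by move: iz; lia.
  by case: (z == 1%N) => /=; ring.
rewrite big_nat1_eq /Theta /= eqxx.
have [->|z1'] := eqVneq z 1%N.
  rewrite /stage_height /=; under eq_bigr do rewrite mulr0.
  by rewrite big1 // /n; ring.
rewrite /stage_height (negPf z1') (_ : _ || _ = false); last lia.
have -> : \sum_(1 <= i < m.+1) (h i.*2 * (~~ false)%:R) = \sum_(1 <= i < m.+1) h i.*2.
  by apply: eq_bigr => i _; rewrite mulr1.
have [_|zn'] := eqVneq z n; rewrite -/n /=.
  by rewrite if_same -natr1; ring.
rewrite (_ : (0 < z./2 < m.+1)%N = true); last by move: zn' z1'; rewrite /n; lia.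
by case: odd; rewrite -!natr1; ring.
Qed.
End Gamma.

(** * Levels of the induction *)

Section Blocks.
Variable R : realType.
Implicit Types (l : nat -> R) (G : R -> R) (a c k r : nat).

Lemma blocks_uptoS n p c1 k : blocks_upto n p c1 k.+1 =
  blocks_upto n p c1 k ++ gamma n (aseq p c1 k.+1) (cseq p c1 k.+1).
Proof.
by rewrite /blocks_upto -[in iota 1 _](addn1 k) iotaD map_cat flatten_cat /= cats0 add1n.
Qed.

Lemma bkiS n p c1 k i : bki n p c1 k.+1 i =
  (\sum_(1 <= s < n.+1) bki n p c1 k s * Theta n (aseq p c1 k.+1) (cseq p c1 k.+1) s i)%N.
Proof.
rewrite /bki /= /mulM exchange_big /=; apply: eq_bigr => s _.
by rewrite add0n big_distrl.
Qed.

Lemma gamma_evolves m a c l st' : let n := m.*2.+2 in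
  evolves (pi_top n, pi_bot n, l) (gamma n a c) st' -> exists l',
    st' = (pi_top n, pi_bot n, l') /\
    forall G, invariant_under (pi_top n) (pi_bot n) l G ->
      invariant_under (pi_top n) (pi_bot n) l' G /\
      forall r, (1 <= r <= n)%N -> piece_mass (pi_top n) l G r =
        \sum_(1 <= s < n.+1) (Theta n a c r s)%:R * piece_mass (pi_top n) l' G s.
Proof.
move=> n; case: st' => [[t b] l'] [_ _ hb [f [_ D]]]; exists l'.
have [h0 [E0 _]] := height_word_gamma m a c (fun=> 0 : R).
(* The final rows do not depend on the heights, so zero heights are enough to read them off. *)
have := hb (fun=> 0); rewrite E0 /= => -[Et Eb]; subst t b; split=> // G inv.
have [inv' _ D'] := D G inv; split=> // r rn.
(* Pairing with the unit height vector at [r] extracts row [r] of the matrix. *)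
have [h [E H]] := height_word_gamma m a c (fun z => (z == r)%:R : R).
have := D' (fun z => (z == r)%:R); rewrite E /=.
have -> : pi_top n = index_iota 1 n.+1 by rewrite /index_iota subn1.
rewrite (eq_big_nat _ _ (F2 := fun s => (Theta n a c r s)%:R * piece_mass (index_iota 1 n.+1) l' G s)).
  move=> ->.
  rewrite (eq_bigr (fun s => if s == r then piece_mass (index_iota 1 n.+1) l G s else 0)).
    by rewrite -big_mkcond big_nat1_eq ltnS rn.
  by move=> s _; case: eqP => _; rewrite ?mul1r ?mul0r.
move=> s sn; rewrite H; last by lia.
congr (_ * _).
rewrite (eq_bigr (fun q => if q == r then (Theta n a c q s)%:R else 0)).
  by rewrite -big_mkcond big_nat1_eq ltnS rn.
by move=> q _; case: eqP => _; rewrite ?mul1r ?mul0r.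
Qed.

Lemma uniq_pairs i k : uniq (pairs i k).
Proof. by elim: k i => // k IH i; rewrite /= !inE -/(pairs _ _) IH !mem_pairs; lia. Qed.

Lemma pi_wf m l : let n := m.*2.+2 in (forall r, (1 <= r <= n)%N -> 0 < l r) ->
  wf (pi_top n) (pi_bot n) l.
Proof.
move=> n lpos; split; first exact: iota_uniq.
  rewrite /n pi_botE; apply: uniq_perm; rewrite ?iota_uniq //.
    by rewrite /= cat_uniq mem_cat !inE /= orbF !mem_pairs uniq_pairs; lia.
  by move=> z; rewrite mem_iota inE mem_cat mem_pairs inE; lia.
by move=> a; rewrite mem_iota => an; apply: lpos; lia.
Qed.

Lemma tiles_self t l G A B : uniq t -> t = A ++ B -> tiles t l G (\sum_(b <- A) l b) B.
Proof.
elim: B A => [//|b B IH] A ut tE /=; split.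
- by rewrite tE mem_cat inE eqxx orbT.
- rewrite tE start_cat //.
  by move: ut; rewrite tE cat_uniq /= negb_or => /and3P[_ /andP[]].
have := IH (rcons A b); rewrite cat_rcons => /(_ ut tE).
by rewrite -cats1 big_cat big_seq1.
Qed.

Lemma sum_piece_mass t l G : uniq t ->
  \sum_(a <- t) piece_mass t l G a = G (\sum_(a <- t) l a) - G 0.
Proof.
move=> ut.
have H A B : t = A ++ B -> \sum_(a <- A) piece_mass t l G a = G (\sum_(a <- A) l a) - G 0.
  elim/last_ind: A B => [|A a IH] B tE; first by rewrite !big_nil subrr.
  rewrite -cats1 !big_cat !big_seq1 /= (IH (a :: B)); last by rewrite tE cat_rcons.
  rewrite /piece_mass {1 2}tE cat_rcons start_cat; first by ring.
  by move: ut; rewrite tE cat_uniq rcons_uniq => /andP[/andP[]].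
by rewrite (H t [::]) // cats0.
Qed.

Section Path.
Variables (m p c1 : nat) (ell : nat -> R).
Let n := m.*2.+2.
Hypothesis ell_pos : forall r, (1 <= r <= n)%N -> 0 < ell r.
Hypothesis path : has_path (T_state n ell) (blocks_upto n p c1).

(** [has_path] says nothing about the states reached. The word read after the first k blocks must be
    the next [gamma], and this word alone forces the rows back to those of pi. *)
Lemma stage_blocks k : exists l,
  rauzy_iter (T_state n ell) (size (blocks_upto n p c1 k)) =
    Some (blocks_upto n p c1 k, (pi_top n, pi_bot n, l)).
Proof.
elim: k => [|k [l E]]; first by exists ell.
have [st'] := path k.+1; rewrite blocks_uptoS size_cat rauzy_iter_add E.
case F: rauzy_iter => [[u st1]|//] [/eqP].
rewrite eqseq_cat // eqxx /= => /eqP uE _; rewrite uE in F *.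
have [wfl _ _ _] := rauzy_iter_evolves (pi_wf ell_pos) E.
have [l' [-> _]] := gamma_evolves (rauzy_iter_evolves wfl F).
by exists l'.
Qed.

Definition blk_len k : nat -> R := (stage (T_state n ell) (size (blocks_upto n p c1 k))).2.

Lemma rauzy_blocks k :
  rauzy_iter (T_state n ell) (size (blocks_upto n p c1 k)) =
    Some (blocks_upto n p c1 k, (pi_top n, pi_bot n, blk_len k)).
Proof. by have [l E] := stage_blocks k; rewrite E /blk_len /stage E. Qed.

Lemma stage_blk_len k : stage (T_state n ell) (size (blocks_upto n p c1 k)) =
  (pi_top n, pi_bot n, blk_len k).
Proof. by rewrite /stage rauzy_blocks. Qed.

Lemma blk_evolves k :
  evolves (T_state n ell) (blocks_upto n p c1 k) (pi_top n, pi_bot n, blk_len k).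
Proof. exact: rauzy_iter_evolves (pi_wf ell_pos) (rauzy_blocks k). Qed.

Lemma blk_wf k : wf (pi_top n) (pi_bot n) (blk_len k).
Proof. by have [] := blk_evolves k. Qed.

Lemma blk_step k : evolves (pi_top n, pi_bot n, blk_len k)
  (gamma n (aseq p c1 k.+1) (cseq p c1 k.+1)) (pi_top n, pi_bot n, blk_len k.+1).
Proof.
apply: (rauzy_iter_evolves (N := size (gamma n (aseq p c1 k.+1) (cseq p c1 k.+1))) (blk_wf k)).
have := rauzy_blocks k.+1; rewrite blocks_uptoS size_cat rauzy_iter_add rauzy_blocks.
case: rauzy_iter => [[u st1]|//] [/eqP].
by rewrite eqseq_cat // eqxx /= => /eqP -> ->.
Qed.

Definition blk_mass G k : nat -> R := piece_mass (pi_top n) (blk_len k) G.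

Section Mass.
Variable G : R -> R.
Hypothesis inv : invariant_under (pi_top n) (pi_bot n) ell G.

Lemma blk_invariant k : invariant_under (pi_top n) (pi_bot n) (blk_len k) G.
Proof. by have [_ _ _ [f [_ D]]] := blk_evolves k; have [] := D G inv. Qed.

Lemma blk_massE k r : (1 <= r <= n)%N -> blk_mass G k r =
  \sum_(1 <= s < n.+1) (Theta n (aseq p c1 k.+1) (cseq p c1 k.+1) r s)%:R
                        * blk_mass G k.+1 s.
Proof.
move=> rn; have [l' [[El] H]] := gamma_evolves (blk_step k).
by rewrite /blk_mass; have [_ ->] := H G (@blk_invariant k); rewrite // -El.
Qed.

(** A Kac formula: b_k v_k = b_k Theta_{k+1} v_{k+1} = b_{k+1} v_{k+1} as products of a row and a
    column, and at level 0 it is the total mass. *)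
Lemma blk_mass_norm k : \sum_(1 <= r < n.+1) ell r = 1 -> G 1 - G 0 = 1 ->
  \sum_(1 <= r < n.+1) (bki n p c1 k r)%:R * blk_mass G k r = 1.
Proof.
move=> ell1 G1; elim: k => [|k IH].
  rewrite (eq_big_nat _ _ (F2 := blk_mass G 0)).
    have := sum_piece_mass (blk_len 0) G (iota_uniq 1 n).
    rewrite /blk_mass /pi_top; have -> : iota 1 n = index_iota 1 n.+1.
      by rewrite /index_iota subn1.
    by move=> ->; rewrite [\sum_(a <- _) _]ell1.
  move=> r rn; rewrite /bki /= /idM (_ : (\sum_(1 <= q < n.+1) _)%N = 1%N) ?mul1r //.
  rewrite (eq_bigr (fun q => if q == r then 1 else 0)%N); last first.
    by move=> q _; case: eqP.
  by rewrite -big_mkcond big_nat1_eq rn.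
rewrite -[RHS]IH.
rewrite [RHS](eq_big_nat _ _ (F2 := fun r => \sum_(1 <= s < n.+1) (bki n p c1 k r)%:R *
    ((Theta n (aseq p c1 k.+1) (cseq p c1 k.+1) r s)%:R * blk_mass G k.+1 s))); last first.
  by move=> r rn; rewrite blk_massE // big_distrr.
rewrite exchange_big /=; apply: eq_bigr => s _.
rewrite bkiS natr_sum big_distrl /=; apply: eq_bigr => r _.
by rewrite natrM mulrA.
Qed.

End Mass.

Lemma blk_tiles k : \sum_(1 <= r < n.+1) ell r = 1 -> exists W,
  \sum_(a <- W) blk_len k a = 1 /\
  forall G, invariant_under (pi_top n) (pi_bot n) ell G ->
    tiles (pi_top n) (blk_len k) G 0 W.
Proof.
move=> ell1; have [_ _ _ [f [S D]]] := blk_evolves k.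
exists (f (pi_top n)); split.
  by rewrite S -ell1 /index_iota subn1.
move=> G /D[_ T _]; apply: T.
by have := @tiles_self (pi_top n) ell G [::] (pi_top n); rewrite big_nil; apply; rewrite ?iota_uniq.
Qed.

End Path.
End Blocks.

(** * Size of return times and masses *)

Section Bounds.
Variable R : realType.
Variables (m p c1 : nat).
Let n := m.*2.+2.
Hypothesis (p1 : (1 < p)%N) (c1pos : (0 < c1)%N).

Lemma cseq_gt0 k : (0 < cseq p c1 k)%N.
Proof. by rewrite muln_gt0 c1pos expn_gt0 ltnW. Qed.

Lemma aseq_gt0 k : (0 < aseq p c1 k)%N.
Proof. by rewrite muln_gt0 cseq_gt0 ltnW. Qed.

Lemma Theta_last_gt0 a c s : (0 < c)%N -> (0 < Theta n a c n s)%N.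
Proof. by move=> c0; rewrite /Theta eqxx /=; case: ifP. Qed.

Lemma Theta_le a c r s : (0 < c <= a)%N -> (Theta n a c r s <= 2 * a)%N.
Proof. by move=> ca; rewrite /Theta; repeat case: ifP => _; lia. Qed.

(** The diagonal entry at (n, n) of block k+1 exceeds c_{k+1} >= p^(2k), and 0 + 2 + ... + 2(k-1) =
    k(k-1). *)
Lemma bki_last_ge k : (p ^ (k * k.-1) <= bki n p c1 k n)%N.
Proof.
elim: k => [|k IH].
  rewrite /bki big_nat_recr //= /idM eqxx; lia.
rewrite bkiS big_nat_recr //=.
apply: leq_trans (leq_addl _ _).
have -> : (k.+1 * k = k * k.-1 + 2 * k)%N by case: k {IH} => //= k; lia.
rewrite expnD leq_mul // /Theta eqxx /=.
apply: leq_trans (leqnSn _); rewrite /cseq /=; exact: leq_pmull.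
Qed.

(** Row n of [Theta] is positive, so one further block spreads the bound from column n to all
    columns; the lost level costs O(k) in the exponent of p. *)
Lemma bki_ge k s : (p ^ (k * k.-1) <= bki n p c1 k.+1 s)%N.
Proof.
apply: leq_trans (bki_last_ge k) _; rewrite bkiS big_nat_recr //=.
apply: leq_trans (leq_addl _ _).
by rewrite leq_pmulr // Theta_last_gt0 // cseq_gt0.
Qed.

(** Every entry of block i is at most 2 a_i = 2 c_1 p^(2i-1), each block contributes a further
    factor n, and 1 + 3 + ... + (2k-1) = k^2. *)
Lemma sum_bki_le k :
  (\sum_(1 <= s < n.+1) bki n p c1 k s <= n * ((2 * n * c1) ^ k * p ^ (k * k)))%N.
Proof.
elim: k => [|k IH].
  rewrite (eq_big_nat _ _ (F2 := fun=> 1%N)); first by rewrite sum_nat_const_nat; lia.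
  move=> s sn; rewrite /bki /= /idM.
  rewrite (eq_bigr (fun q => if q == s then 1 else 0)%N).
    by rewrite -big_mkcond big_nat1_eq sn.
  by move=> q _; case: eqP.
have -> : (k.+1 * k.+1 = k * k + (2 * k).+1)%N by lia.
have ca : (0 < cseq p c1 k.+1 <= aseq p c1 k.+1)%N.
  by rewrite cseq_gt0 leq_pmull // ltnW.
apply: (@leq_trans (\sum_(1 <= s < n.+1) (\sum_(1 <= l < n.+1) bki n p c1 k l) * (2 * aseq p c1 k.+1))).
  apply: leq_sum => s _; rewrite bkiS big_distrl /=; apply: leq_sum => l _.
  by rewrite leq_mul2l Theta_le ?orbT.
rewrite sum_nat_const_nat subn1 /=.
apply: (@leq_trans (n * (n * ((2 * n * c1) ^ k * p ^ (k * k)) * (2 * aseq p c1 k.+1)))).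
  by rewrite leq_mul2l leq_mul2r IH !orbT.
rewrite /aseq /cseq /= expnSr expnD expnS; lia.
Qed.

Variable v : nat -> nat -> R.
Hypothesis v_ge0 : forall k r, (1 <= r <= n)%N -> 0 <= v k r.
Hypothesis vE : forall k r, (1 <= r <= n)%N -> v k r =
  \sum_(1 <= s < n.+1) (Theta n (aseq p c1 k.+1) (cseq p c1 k.+1) r s)%:R * v k.+1 s.
Hypothesis v1 : forall k, \sum_(1 <= r < n.+1) (bki n p c1 k r)%:R * v k r = 1.

Lemma v_le_step k r s : (1 <= r <= n)%N -> (1 <= s <= n)%N ->
  (0 < Theta n (aseq p c1 k.+1) (cseq p c1 k.+1) r s)%N -> v k.+1 s <= v k r.
Proof.
move=> rn sn T0; rewrite (vE k rn).
rewrite (bigD1_seq s) ?mem_index_iota ?iota_uniq //=.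
apply: ler_wpDr; last by rewrite ler_peMl ?v_ge0 // ler1n.
rewrite big_nat_cond sumr_ge0 // => q /andP[qn _].
by rewrite mulr_ge0 // v_ge0; lia.
Qed.

(* The positivity of a product of three consecutive matrices [Theta]. *)
Lemma v_le_step3 k r s : (1 <= r <= n)%N -> (1 <= s <= n)%N -> v k.+3 s <= v k r.
Proof.
move=> rn sn.
(* Positive entries form a route from any row to any column: row n is full, an even row has a
   positive entry in column n, and an odd row r other than 1 has the entry a in column r - 1. Row 1
   is full as well; shorter routes are padded with diagonal entries. *)
have Ln k' q : (1 <= q <= n)%N -> v k'.+1 q <= v k' n.
  by move=> qn; apply: v_le_step; rewrite ?Theta_last_gt0 ?cseq_gt0 //; lia.
have nn : (1 <= n <= n)%N by lia.
have Lev k' q i : ~~ odd i -> (1 <= i < n)%N -> (1 <= q <= n)%N -> v k'.+2 q <= v k' i.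
  move=> oi im qn; apply: le_trans (Ln _ _ qn) _; apply: v_le_step; [lia|lia|].
  rewrite /Theta (_ : (i == 1)%N = false); last by move: oi im; case: (i) => [|[]].
  by rewrite (_ : (i == n)%N = false) ?oi; last lia; repeat case: ifP.
have [->|rn'] := eqVneq r n.
  by apply: le_trans (Ln _ _ sn) _; apply: le_trans (Ln _ _ nn) _; exact: Ln.
have [->|r1] := eqVneq r 1%N.
  have L1 k' q : (1 <= q <= n)%N -> v k'.+1 q <= v k' 1%N.
    move=> qn; apply: v_le_step => //; rewrite /Theta /=.
    by case: ifP => // _; exact: cseq_gt0.
  have n1 : (1 <= 1 <= n)%N by [].
  by apply: le_trans (L1 _ _ sn) _; apply: le_trans (L1 _ _ n1) _; exact: L1.
have [odr|evr] := boolP (odd r); last first.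
  by apply: le_trans (Ln _ _ sn) _; apply: Lev => //; lia.
have rp : (1 <= r.-1 < n)%N by lia.
apply: le_trans (Lev k.+1 s r.-1 _ rp sn) _; first by move: odr rp; case: (r).
apply: v_le_step; [lia|lia|].
by rewrite /Theta (negPf r1) (negPf rn') odr eqxx aseq_gt0.
Qed.

Lemma v_upper k r : (1 <= r <= n)%N -> (bki n p c1 k r)%:R * v k r <= 1.
Proof.
move=> rn; rewrite -[leRHS](v1 k).
rewrite (bigD1_seq r) ?mem_index_iota ?iota_uniq //= lerDl.
rewrite big_nat_cond sumr_ge0 // => q /andP[qn _].
by rewrite mulr_ge0 // v_ge0; lia.
Qed.

(** In the normalisation at level k+3 every mass is at most v_{k,r}. Three extra levels change the
    logarithm of the total height by O(k) only. *)
Lemma v_lower k r : (1 <= r <= n)%N ->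
  1 <= (\sum_(1 <= s < n.+1) bki n p c1 k.+3 s)%N%:R * v k r.
Proof.
move=> rn; rewrite -[leLHS](v1 k.+3) natr_sum mulr_suml.
rewrite [leLHS]big_nat_cond [leRHS]big_nat_cond ler_sum // => s /andP[sn _].
by rewrite ler_wpM2l // v_le_step3 //; lia.
Qed.

Let L : R := ln p%:R.
Let L0 : 0 < L. Proof. by rewrite ln_gt0 // ltr1n. Qed.

(* Every logarithm attached to level [k] is [k ^ 2 * ln p + O(k)]. *)
Definition quadratic (f : nat -> R) (B : R) :=
  forall k, - B * k.+1%:R <= f k - L * k%:R ^+ 2 <= B * k.+1%:R.

Let K : R := ln (2 * n * c1)%:R.
Let K0 : 0 <= K. Proof. by rewrite ln_ge0 // ler1n /n; lia. Qed.

Lemma bki_gt0 k r : (1 <= r <= n)%N -> (0 < bki n p c1 k r)%N.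
Proof.
case: k => [|k] rn; last first.
  by apply: leq_trans (bki_ge k r); rewrite expn_gt0; lia.
rewrite /bki /= /idM (eq_bigr (fun q => if q == r then 1 else 0)%N).
  by rewrite -big_mkcond big_nat1_eq ltnS rn.
by move=> q _; case: eqP.
Qed.

Lemma bki_le_sum k r : (1 <= r <= n)%N ->
  (bki n p c1 k r <= \sum_(1 <= s < n.+1) bki n p c1 k s)%N.
Proof.
by move=> rn; rewrite (bigD1_seq r) ?mem_index_iota ?iota_uniq //= leq_addr.
Qed.

Lemma ln_sum_bki_le k : ln (\sum_(1 <= s < n.+1) bki n p c1 k s)%N%:R
  <= ln n%:R + k%:R * K + k%:R ^+ 2 * L.
Proof.
have n1 : (1 <= 1 <= n)%N by [].
have S0 : (0 < \sum_(1 <= s < n.+1) bki n p c1 k s)%N.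
  exact: leq_trans (bki_gt0 k n1) (bki_le_sum k n1).
have p0 : (0 < p)%N by exact: ltnW.
have c0 : (0 < 2 * n * c1)%N by rewrite !muln_gt0 c1pos.
apply: (@le_trans _ _ (ln (n * ((2 * n * c1) ^ k * p ^ (k * k)))%:R)).
  rewrite ler_ln ?posrE ?ltr0n ?ler_nat ?sum_bki_le //.
  by apply: leq_trans S0 (sum_bki_le k).
rewrite natrM natrM [((2 * n * c1) ^ k)%:R]natrX [(p ^ _)%:R]natrX.
rewrite !lnM ?posrE ?mulr_gt0 ?exprn_gt0 ?ltr0n //.
have -> : ln ((2 * n * c1)%:R ^+ k) = k%:R * K by rewrite lnXn ?ltr0n // mulr_natl.
have -> : ln (p%:R ^+ (k * k)) = k%:R ^+ 2 * L by rewrite lnXn ?ltr0n // -[LHS]mulr_natl natrM expr2.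
by rewrite addrA.
Qed.

Lemma ln_bki_ge k r : (1 <= r <= n)%N ->
  L * k%:R ^+ 2 - 3 * L * k.+1%:R <= ln (bki n p c1 k r)%:R.
Proof.
move=> rn; case: k => [|k].
  rewrite expr0n mulr0 mulr1; apply: (@le_trans _ _ 0); first by have := L0; lra.
  by rewrite ln_ge0 // ler1n bki_gt0.
(* The level is k+1 here, and k(k-1) = (k+1)^2 - 3(k+1) + 2 is the origin of the factor 3. *)
apply: (@le_trans _ _ (ln (p ^ (k * k.-1))%:R)); last first.
  by rewrite ler_ln ?posrE ?ltr0n ?ler_nat ?bki_ge ?bki_gt0 // expn_gt0; lia.
rewrite natrX lnXn ?ltr0n; last lia.
rewrite -/L -[leRHS]mulr_natl natrM -!natr1.
have -> : k%:R * k.-1%:R = k%:R * (k%:R - 1) :> R.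
  by case: (k) => [|k']; rewrite ?mul0r //= -natr1 addrK.
have := mulr_ge0 (ltW L0) (ler0n R k); have := L0; nra.
Qed.

Lemma quadratic_bounds : exists B, [/\ 0 <= B,
  forall r, (1 <= r <= n)%N -> quadratic (fun k => ln (bki n p c1 k r)%:R) B,
  forall k r, (1 <= r <= n)%N -> 0 < v k r &
  forall r, (1 <= r <= n)%N -> quadratic (fun k => - ln (v k r)) B].
Proof.
have n0 : 0 <= ln (n%:R : R) by rewrite ln_ge0 // ler1n.
have v_gt0 k r : (1 <= r <= n)%N -> 0 < v k r.
  move=> rn; rewrite lt_neqAle v_ge0 // andbT eq_sym; apply/eqP => v0.
  by have := v_lower k rn; rewrite v0 mulr0 ler10.
have L0' := L0; have K0' := K0.
have zK k : 0 <= k%:R * K by rewrite mulr_ge0.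
have zL k : 0 <= k%:R * L by rewrite mulr_ge0 // ltW.
have zn k : 0 <= k%:R * ln (n%:R : R) by rewrite mulr_ge0.
(* The worst case is the upper bound ln n + (k+3) K + (k+3)^2 L at level k+3, where (k+3)^2 <= k^2 +
   9(k+1) and k+3 <= 3(k+1). *)
exists (9 * L + 3 * K + ln n%:R); split=> //; first by lra.
- move=> r rn k; have H1 := ln_bki_ge k rn.
  have H2 : ln (bki n p c1 k r)%:R <= ln (\sum_(1 <= s < n.+1) bki n p c1 k s)%N%:R :> R.
    rewrite ler_ln ?posrE ?ltr0n ?ler_nat ?bki_le_sum ?bki_gt0 //.
    exact: leq_trans (bki_gt0 k rn) (bki_le_sum k rn).
  have H3 := le_trans H2 (ln_sum_bki_le k).
  move: H1 H3 (zK k) (zL k) (zn k) L0' K0' n0; rewrite -[k.+1%:R]natr1.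
  move: (ln (bki _ _ _ _ _)%:R) (k%:R) (K) (L) (ln n%:R) => x z K' L' N H1 H3 *.
  by apply/andP; split; lra.
- move=> r rn k.
  have H3 : ln (bki n p c1 k r)%:R <= - ln (v k r).
    rewrite -lnV ?posrE ?v_gt0 // ler_ln ?posrE ?invr_gt0 ?v_gt0 ?ltr0n ?bki_gt0 //.
    by rewrite -[leRHS]mul1r ler_pdivlMr ?v_gt0 // v_upper.
  have H4 : - ln (v k r) <= ln (\sum_(1 <= s < n.+1) bki n p c1 k.+3 s)%N%:R.
    rewrite -lnV ?posrE ?v_gt0 // ler_ln ?posrE ?invr_gt0 ?v_gt0 ?ltr0n //; last first.
      exact: leq_trans (bki_gt0 k.+3 rn) (bki_le_sum k.+3 rn).
    by rewrite -[leLHS]mul1r ler_pdivrMr ?v_gt0 // v_lower.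
  have H1 := le_trans (ln_bki_ge k rn) H3.
  have := le_trans H4 (ln_sum_bki_le k.+3).
  move: H1 (zK k) (zL k) (zn k) L0' K0' n0.
  rewrite -[k.+3%:R]natr1 -[k.+2%:R]natr1 -[k.+1%:R]natr1.
  move: (ln (v _ _)) (k%:R) (K) (L) (ln n%:R) => x z K' L' N H1 *.
  by apply/andP; split; lra.
Qed.
End Bounds.

(** * Invariant measures of an interval exchange *)

Section Exchange.
Variable R : realType.
Implicit Types (l : nat -> R) (t b A B U V W : seq nat) (a c : nat) (x y : R).

Lemma locate W l x : 0 <= x < \sum_(a <- W) l a -> exists U a V,
  W = U ++ a :: V /\ \sum_(b <- U) l b <= x < \sum_(b <- U) l b + l a.
Proof.
elim/last_ind: W => [|W a IH]; first by rewrite big_nil; lra.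
rewrite -cats1 big_cat big_seq1 /= => /andP[x0 xlt].
have [xl|xl] := ltP x (\sum_(b <- W) l b).
  have [|U [c [V [-> H]]]] := IH; first by rewrite x0.
  by exists U, c, (V ++ [:: a]); rewrite -catA.
by exists W, a, [::]; rewrite xl.
Qed.

Section Rows.
Variables (t b : seq nat) (l : nat -> R).
Hypotheses (ut : uniq t) (tb : perm_eq t b) (lpos : forall a, a \in t -> 0 < l a).

Lemma start_bounds s a : perm_eq t s -> a \in s ->
  0 <= start s l a /\ start s l a + l a <= \sum_(c <- t) l c.
Proof.
move=> ts sa; have [A [B [E aA]]] := mem_split sa; subst s.
have pos c : c \in A ++ a :: B -> 0 <= l c by rewrite -(perm_mem ts) => /lpos/ltW.
rewrite (perm_big _ ts) start_cat // big_cat big_cons /=; split.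
  by rewrite big_seq sumr_ge0 // => c cA; rewrite pos // mem_cat cA.
rewrite addrA lerDl big_seq sumr_ge0 // => c cB.
by rewrite pos // mem_cat inE cB !orbT.
Qed.

Lemma start_disjoint s a c x : perm_eq t s -> a \in s -> c \in s ->
  start s l a <= x < start s l a + l a -> start s l c <= x < start s l c + l c -> a = c.
Proof.
move=> ts; have us : uniq s by rewrite -(perm_uniq ts).
have pos d : d \in s -> 0 <= l d by rewrite -(perm_mem ts) => /lpos/ltW.
have key A d B e : s = A ++ d :: B -> d \notin A -> e \in B ->
    start s l d + l d <= start s l e.
  move=> E dA eB; have [B1 [B2 [EB eB1]]] := mem_split eB.
  have eA : e \notin A ++ d :: B1.
    move: us; rewrite E EB -cat_cons catA cat_uniq => /and3P[_ + _].
    by rewrite /= negb_or => /andP[].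
  have posB d' : d' \in B1 -> 0 <= l d'.
    by move=> dB; apply: pos; rewrite E EB mem_cat inE mem_cat dB !orbT.
  rewrite {1}E start_cat // E EB -cat_cons catA start_cat // big_cat big_cons /=.
  by rewrite addrA lerDl big_seq sumr_ge0.
move=> sa sc Ha Hc; have [//|ac] := eqVneq a c; exfalso.
have [A [B [E aA]]] := mem_split sa.
move: (sc); rewrite E mem_cat inE (eq_sym c) (negPf ac) /= => /orP[cA|cB].
  have [A1 [A2 [EA cA1]]] := mem_split cA.
  have := @key A1 c (A2 ++ a :: B) a; rewrite E EA -catA /= mem_cat inE eqxx orbT -/cat.
  move=> /(_ erefl cA1 isT); rewrite -[A1 ++ _]/(A1 ++ (c :: A2) ++ a :: B) catA -EA -E.
  by move: Ha Hc; lra.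
by have := key _ _ _ _ E aA cB; move: Ha Hc; lra.
Qed.

Lemma iet_in a x : a \in t -> start t l a <= x < start t l a + l a ->
  iet t b l x = x + (start b l a - start t l a).
Proof.
move=> at_ xa; rewrite /iet (bigD1_seq a) //= xa big_seq_cond big1 ?addr0 //.
move=> c /andP[ct ca]; case: ifP => // xc.
by move: ca; rewrite (start_disjoint (perm_refl t) ct at_ xc xa) eqxx.
Qed.

Lemma iet_out x : ~ (0 <= x < \sum_(c <- t) l c) -> iet t b l x = x.
Proof.
move=> xout; rewrite /iet big_seq big1 ?addr0 // => c ct; case: ifP => // xc.
exfalso; apply: xout; have := start_bounds (perm_refl t) ct; move: xc; lra.
Qed.

Lemma iet_preimage a u : a \in t -> u <= l a ->
  iet t b l @^-1` `[start b l a, start b l a + u[%classic =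
  `[start t l a, start t l a + u[%classic.
Proof.
move=> at_ ul; have ab : a \in b by rewrite -(perm_mem tb).
have [Hb1 Hb2] := start_bounds tb ab.
apply/seteqP; split=> x /=; rewrite !in_itv /=; last first.
  by move=> xa; rewrite (iet_in at_); move: xa; lra.
move=> Tx.
(* [iet] is the identity outside the exchanged interval, so a point there cannot enter the image of
   [a]. *)
have [xin|xout] := pselect (0 <= x < \sum_(c <- t) l c); last first.
  by exfalso; rewrite iet_out // in Tx; apply: xout; lra.
have [U [c [V [E xc]]]] := locate xin.
have ct : c \in t by rewrite E mem_cat inE eqxx orbT.
have cU : c \notin U.
  by move: ut; rewrite E cat_uniq /= negb_or => /and3P[_ /andP[]].
have sc : start t l c = \sum_(d <- U) l d by rewrite E start_cat.
rewrite -sc in xc; rewrite (iet_in ct xc) in Tx.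
have cb : c \in b by rewrite -(perm_mem tb).
have ac : a = c by apply: (start_disjoint tb ab cb (x := x + (start b l c - start t l c))); lra.
by move: Tx; rewrite ac; lra.
Qed.

End Rows.
End Exchange.

(** * Distribution functions of invariant measures *)

Section CDF.
Variable R : realType.
Variable mu : probability R R.

(** With the right end left out, increments are exactly the masses of the intervals [x, y), the
    shape of the exchanged intervals, whether or not there are atoms. *)
Definition cdf0 (x : R) : R := fine (mu `[0, x[%classic).

Let mu_fin (A : set R) : measurable A -> mu A \is a fin_num.
Proof. by move=> mA; apply: fin_num_measure. Qed.

Lemma cdf0B x y : 0 <= x <= y -> cdf0 y - cdf0 x = fine (mu `[x, y[%classic).
Proof.
move=> /andP[x0 xy]; rewrite /cdf0.
have -> : `[0, y[%classic = `[0, x[%classic `|` `[x, y[%classic :> set R.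
  by rewrite (@itv_bndbnd_setU _ _ (BLeft 0) (BLeft x)) ?bnd_simp.
rewrite measureU //; last first.
  by apply/seteqP; split => z //= []; rewrite !in_itv /=; lra.
rewrite fineD ?mu_fin //; lra.
Qed.

Lemma cdf0_le x y : 0 <= x <= y -> cdf0 x <= cdf0 y.
Proof. by move=> xy; rewrite -subr_ge0 cdf0B // fine_ge0. Qed.

Lemma cdf00 : cdf0 0 = 0.
Proof. by rewrite /cdf0 set_itvco0 measure0. Qed.

Lemma cdf01 : mu `[0, 1[%classic = 1%E -> cdf0 1 = 1.
Proof. by rewrite /cdf0 => ->. Qed.

Lemma cdf0_invariant t b l : uniq t -> perm_eq t b -> (forall a, a \in t -> 0 < l a) ->
  (forall A : set R, measurable A -> mu (iet t b l @^-1` A) = mu A) ->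
  invariant_under t b l cdf0.
Proof.
move=> ut tb lpos inv a at_ u /andP[u0 ul].
have ab : a \in b by rewrite -(perm_mem tb).
have [st _] := start_bounds lpos (perm_refl t) at_.
have [sb _] := start_bounds lpos tb ab.
by rewrite !cdf0B -?(iet_preimage ut tb lpos at_ ul) ?inv //; lra.
Qed.
End CDF.

(** * Masses of intervals *)

Section Partition.
Variable R : realType.
Implicit Types (l : nat -> R) (X U V W A : seq nat) (a c : nat) (x y : R) (S : set R).

Lemma tiles_cat X l G x U a V : tiles X l G x (U ++ a :: V) ->
  a \in X /\ translates G (x + \sum_(b <- U) l b) (start X l a) (l a).
Proof.
elim: U x => [|b U IH] x /= []; first by rewrite big_nil addr0.
by move=> _ _ /IH[aX H]; rewrite big_cons addrA.
Qed.

Lemma tiles_mass X l G U a V : tiles X l G 0 (U ++ a :: V) -> 0 <= l a ->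
  G (\sum_(b <- U) l b + l a) - G (\sum_(b <- U) l b) = piece_mass X l G a.
Proof. by move=> /tiles_cat[_ H] la; rewrite add0r in H; rewrite H // lexx la. Qed.

Section Level.
Variables (F : R -> R) (W : seq nat) (l : nat -> R) (M : R).
Hypothesis Fle : forall x y, 0 <= x <= y -> F x <= F y.
Hypothesis lpos : forall a, a \in W -> 0 < l a.
Hypothesis FM : forall U a V, W = U ++ a :: V ->
  F (\sum_(b <- U) l b + l a) - F (\sum_(b <- U) l b) <= M.

Let prefix_ge0 U V : W = U ++ V -> 0 <= \sum_(b <- U) l b.
Proof.
by move=> E; rewrite big_seq sumr_ge0 // => b bU; apply/ltW/lpos; rewrite E mem_cat bU.
Qed.

Let letter_pos U a V : W = U ++ a :: V -> 0 < l a.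
Proof. by move=> E; apply: lpos; rewrite E mem_cat inE eqxx orbT. Qed.

(** Either [x, y) stays within the floor of x and the next one, or it contains that next floor
    entirely. *)
Lemma level_dichotomy (G : R -> R) (c x y : R) :
  (forall x y, 0 <= x <= y -> G x <= G y) ->
  (forall U a V, W = U ++ a :: V ->
    c <= G (\sum_(b <- U) l b + l a) - G (\sum_(b <- U) l b)) ->
  0 <= M -> 0 <= x <= y -> y <= \sum_(a <- W) l a ->
  F y - F x <= 2 * M \/ c <= G y - G x.
Proof.
move=> Gle Gc M0 /andP[x0 xy] yW.
have [xW|xW] := ltP x (\sum_(a <- W) l a); last first.
  have -> : y = x by lra.
  by left; lra.
have [|U [a [V [E xa]]]] := @locate _ W l x; first by rewrite x0.
have [U0 la] := (prefix_ge0 E, letter_pos E).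
have := FM E; have [ya FMa|ya FMa] := leP y (\sum_(b <- U) l b + l a).
  left; have := @Fle y (\sum_(b <- U) l b + l a); have := @Fle (\sum_(b <- U) l b) x.
  by move: xa => /andP[-> _]; rewrite U0 ya (le_trans x0 xy) => /(_ isT) ? /(_ isT) ?; lra.
case: V E => [|a' V] E.
  by exfalso; move: yW ya; rewrite E big_cat big_seq1 /=; lra.
have E' : W = rcons U a ++ a' :: V by rewrite cat_rcons.
have S' : \sum_(b <- rcons U a) l b = \sum_(b <- U) l b + l a.
  by rewrite -cats1 big_cat big_seq1.
have la' := letter_pos E'; have FMa' := FM E'; have Gc' := Gc _ _ _ E'.
rewrite S' in FMa' Gc'.
move: {E E' S'} FMa FMa' Gc' xa ya U0 la la'; move: (\sum_(b <- U) l b) => q.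
move=> FMa FMa' Gc' /andP[qx xq] ya q0 la la'.
have [ya'|ya'] := leP y (q + l a + l a').
  left; have := @Fle y (q + l a + l a'); have := @Fle q x.
  by rewrite q0 ya' qx (le_trans x0 xy) => /(_ isT) ? /(_ isT) ?; lra.
right; have := @Gle (q + l a + l a') y ltac:(lra); have := @Gle x (q + l a) ltac:(lra).
lra.
Qed.

(** A level has finitely many floors, ordered from left to right, so a leftmost floor meeting [S]
    exists even if [S] has no least point. *)
Lemma first_floor S W' : (forall z, S z -> 0 <= z) ->
  (exists2 z, S z & z < \sum_(a <- W') l a) ->
  exists U a V, [/\ W' = U ++ a :: V, forall z, S z -> \sum_(b <- U) l b <= z &
    exists2 x, S x & x < \sum_(b <- U) l b + l a].
Proof.
move=> S0; elim/last_ind: W' => [|W' a IH] [z Sz].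
  by rewrite big_nil ltNge S0.
rewrite -cats1 big_cat big_seq1 /= => za.
have [H|H] := pselect (exists2 z, S z & z < \sum_(a <- W') l a).
  have [U [c [V [-> H1 H2]]]] := IH H.
  by exists U, c, (V ++ [:: a]); rewrite -catA.
exists W', a, [::]; split=> //; last by exists z.
by move=> y Sy; rewrite leNgt; apply/negP => ?; apply: H; exists y.
Qed.

Lemma last_floor S W' : (exists2 z, S z & 0 <= z) ->
  (forall z, S z -> z < \sum_(a <- W') l a) ->
  exists U a V, [/\ W' = U ++ a :: V, forall z, S z -> z < \sum_(b <- U) l b + l a &
    exists2 y, S y & \sum_(b <- U) l b <= y].
Proof.
move=> [z0 Sz0 z00]; elim/last_ind: W' => [|W' a IH] SW.
  by have := SW _ Sz0; rewrite big_nil ltNge z00.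
have [[y Sy yW]|H] := pselect (exists2 y, S y & \sum_(a <- W') l a <= y).
  exists W', a, [::]; split; [by rewrite cats1| |by exists y].
  by move=> z /SW; rewrite -cats1 big_cat big_seq1.
have [|U [c [V [-> H1 H2]]]] := IH.
  by move=> z Sz; rewrite ltNge; apply/negP => ?; apply: H; exists z.
by exists U, c, (V ++ [:: a]); rewrite -cats1 -catA.
Qed.

(* Taking [x] and [y] in [S] itself, rather than the infimum and supremum of [S],
   makes the continuity of [F] unnecessary. *)
Lemma level_hull S : S !=set0 -> (forall z, S z -> 0 <= z < \sum_(a <- W) l a) ->
  exists x y q q', [/\ S x, S y, 0 <= x <= y & [/\ 0 <= q <= q',
     forall z, S z -> q <= z < q' & F q' - F q <= F y - F x + 2 * M]].
Proof.
move=> [z0 Sz0] S01.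
have [|| U [a [V [E Sge [x Sx xa]]]]] := @first_floor S W.
- by move=> z /S01/andP[].
- by exists z0 => //; have /andP[] := S01 _ Sz0.
have [|| U' [a' [V' [E' Slt [y' Sy' ya']]]]] := @last_floor S W.
- by exists z0 => //; have /andP[] := S01 _ Sz0.
- by move=> z /S01/andP[].
have [y [Sy xy yge]] : exists y, [/\ S y, x <= y & \sum_(b <- U') l b <= y].
  have [?|?] := leP x y'; first by exists y'.
  by exists x; split=> //; lra.
have [U0 U0'] := (prefix_ge0 E, prefix_ge0 E').
have yq' := Slt _ Sy; have qx := Sge _ Sx.
exists x, y, (\sum_(b <- U) l b), (\sum_(b <- U') l b + l a'); split=> //.
  by apply/andP; split; lra.
split; first by apply/andP; split; lra.
  by move=> z Sz; rewrite Sge ?Slt.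
have := FM E; have := FM E'.
have := @Fle x (\sum_(b <- U) l b + l a) ltac:(lra).
have := @Fle (\sum_(b <- U') l b) y ltac:(lra).
lra.
Qed.

End Level.

Lemma level_mass_small (L B e : R) : 0 < L -> 0 <= B -> 0 < e ->
  exists k, 2 * expR (- L * k%:R ^+ 2 + B * k.+1%:R) < e.
Proof.
move=> L0 B0 e0; pose T := `|ln (e / 2)|.
have T0 : 0 <= T := normr_ge0 _.
have r0 : 0 <= (2 * B + T + 1) / L by apply: divr_ge0; [lra|exact: ltW].
(* For k >= 1 beyond this bound, L k^2 > (2B + T + 1) k >= B(k+1) + T, and -T <= ln (e/2). *)
exists (Num.Def.archi_bound ((2 * B + T + 1) / L)).
have := archi_boundP r0; set k := Num.Def.archi_bound _ => kb.
have k1 : 1 <= k%:R :> R by rewrite ler1n lt0n; apply: contraTneq kb => ->; rewrite -leNgt.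
rewrite -ltr_pdivlMl // [ltRHS]mulrC -[ltRHS]lnK ?posrE ?divr_gt0 // ltr_expR.
rewrite ltr_pdivrMr // in kb.
have T1 : - T <= ln (e / 2) by rewrite lerNl ler_normr lexx orbT.
have k0 : 0 <= k%:R - 1 :> R by rewrite subr_ge0.
have := mulr_ge0 k0 T0; have := mulr_ge0 k0 B0.
have : (2 * B + T + 1) * k%:R < k%:R * L * k%:R by rewrite ltr_pM2r // (lt_le_trans _ k1).
rewrite -[k.+1%:R]natr1; move: T1; move: (ln _) (k%:R) k1 => u z k1 *; lra.
Qed.

(* The exponents [L k ^ 2] of the upper and lower bounds agree up to [O(k)], so
   any [s < 1] absorbs the linear error terms. *)
Lemma holder_of_levels (F G : R -> R) (L B s : R) : 0 < L -> 0 <= B -> 0 <= s < 1 ->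
  (forall x y, 0 <= x <= y -> y <= 1 -> F y - F x <= 1 /\ 0 <= G y - G x) ->
  (forall k x y, 0 <= x <= y -> y <= 1 ->
     F y - F x <= 2 * expR (- L * k%:R ^+ 2 + B * k.+1%:R) \/
     expR (- L * k%:R ^+ 2 - B * k.+1%:R) <= G y - G x) ->
  exists2 C, 0 < C & forall x y, 0 <= x <= y -> y <= 1 ->
    F y - F x <= C * (G y - G x) `^ s.
Proof.
move=> L0 B0 /andP[s0 s1] FG dich.
pose m k : R := expR (- L * k%:R ^+ 2 - B * k.+1%:R).
(* At consecutive levels k and k+1 the exponent to be bounded is 1 - L k^2 + B(k+1) + s (L(k+1)^2 +
   B(k+2)) = - al k^2 + be k + const, where the 1 absorbs the factor 2 <= e. Its maximum over real k
   is at t = be / (2 al), with value [D]. *)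
pose al := (1 - s) * L; pose be := B + 2 * s * L + s * B.
have al0 : 0 < al by rewrite mulr_gt0 // subr_gt0.
pose t := be / (2 * al).
have bet : be = 2 * al * t by rewrite /t mulrCA divff ?mulr1 // mulf_neq0 ?pnatr_eq0 ?gt_eqF.
pose D := al * t ^+ 2 + (1 + B + s * L + 2 * s * B).
exists (expR D + expR (s * B)); first by rewrite addr_gt0 ?expR_gt0.
move=> x y xy y1; have [F1 g0] := FG _ _ xy y1.
have C0 z : 0 <= (expR D + expR (s * B)) * z `^ s.
  by apply: mulr_ge0; rewrite ?powR_ge0 //; apply: addr_ge0; exact: expR_ge0.
have [f0|f0] := leP (F y - F x) 0; first exact: le_trans (C0 _).
have mpow k : m k <= G y - G x -> expR ((- L * k%:R ^+ 2 - B * k.+1%:R) * s) <= (G y - G x) `^ s.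
  by move=> mg; rewrite expRM ge0_ler_powR ?nnegrE ?expR_ge0.
have ex : exists k, `[< m k <= G y - G x >].
  have [k kf] := level_mass_small L0 B0 f0; exists k; apply/asboolP.
  by have [abs|] := dich k _ _ xy y1; [move: abs; rewrite leNgt kf|].
(* At the least level k+1 whose floor mass fits below G y - G x, level k does not fit, so the
   dichotomy bounds F y - F x at level k. If level 0 already fits, F y - F x <= 1 and the term expR
   (s * B) of the constant is enough. *)
case: (ex_minnP ex) => -[|k] /asboolP mk kmin.
  apply: le_trans F1 _; have := mpow _ mk; rewrite expr0n mulr0 mulr1 => H.
  rewrite -(expRxMexpNx_1 (s * B)); apply: ler_pM; rewrite ?expR_ge0 //.
    by rewrite lerDr expR_ge0.
  by apply: le_trans H; rewrite ler_expR; lra.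
have [|abs] := dich k _ _ xy y1; last first.
  by have := kmin k (introT (asboolP _) abs); rewrite ltnn.
move=> /le_trans; apply.
apply: (@le_trans _ _ (expR D * expR ((- L * k.+1%:R ^+ 2 - B * k.+2%:R) * s))); last first.
  apply: ler_pM; [exact: expR_ge0|exact: expR_ge0| |exact: mpow].
  by rewrite lerDl expR_ge0.
apply: (@le_trans _ _ (expR 1 * expR (- L * k%:R ^+ 2 + B * k.+1%:R))).
  by rewrite ler_wpM2r ?expR_ge0 //; have := expR_ge1Dx (1 : R); lra.
rewrite -!expRD ler_expR -[k.+2%:R]natr1 -[k.+1%:R]natr1.
have : 0 <= al * (k%:R - t) ^+ 2 by rewrite mulr_ge0 ?sqr_ge0 // ltW.
have : be * k%:R = 2 * al * t * k%:R by rewrite bet.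
by rewrite /D /al /be; move: (k%:R) (t) => z t' *; lra.
Qed.

End Partition.

(** * Hausdorff dimension for d_nu *)

Section Hausdorff.
Variable R : realType.
Implicit Types (d : R -> R -> R) (s x y : R) (U A : set R).

Lemma diam_ge d U x y : U x -> U y -> ((d x y)%:E <= diam d U)%E.
Proof. by move=> Ux Uy; apply: ereal_sup_ubound; exists (x, y). Qed.

Lemma hcontrib_ge0 d s U : (0 <= hcontrib d s U)%E.
Proof. by rewrite /hcontrib; case: ifP => // _; rewrite lee_fin powR_ge0. Qed.

Lemma hcontrib_ge d s U x y : 0 <= s -> (forall x y, 0 <= d x y) -> (diam d U <= 1)%E ->
  U x -> U y -> ((d x y `^ s)%:E <= hcontrib d s U)%E.
Proof.
move=> s0 d0 U1 Ux Uy; have dU := diam_ge d Ux Uy; rewrite /hcontrib ifF; last first.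
  by apply/asboolP => U0; rewrite U0 in Ux.
have Ufin : diam d U \is a fin_num.
  rewrite fin_numE; apply/andP; split; apply/negP => /eqP E.
    by rewrite E leeNy_eq in dU.
  by rewrite E in U1.
rewrite lee_fin ge0_ler_powR // ?nnegrE ?d0 //; last by rewrite -lee_fin fineK.
by rewrite fine_ge0 // (le_trans _ dU) // lee_fin.
Qed.

(** The mass distribution principle at scale 1. Covering sets are arbitrary and perhaps not
    measurable, so each is cut down to [A] and enclosed in an interval, at a cost eps / 2^(k+1) for
    the k-th; summation gives 1 <= C * sum + eps. *)
Lemma hausdorff_measure_gt0 (mu : probability R R) d s C A : 0 <= s -> 0 < C ->
  (forall x y, 0 <= d x y) -> measurable A -> mu A = 1%E ->
  (forall eps U, 0 < eps -> U `<=` A -> U !=set0 -> exists x y q q',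
    [/\ U x, U y, U `<=` `[q, q'[%classic &
        fine (mu `[q, q'[%classic) <= C * d x y `^ s + eps]) ->
  hausdorff_measure d s A <> 0%E.
Proof.
move=> s0 C0 d0 mA A1 hull H0.
have : ((C^-1)%:E <= hausdorff_measure d s A)%E.
  apply: (@le_trans _ _ (hausdorff_delta d s 1 A)); last first.
    by apply: ereal_sup_ubound; exists 1 => //=.
  apply/ereal_infP => _ [F [AF Fdiam] <-].
  rewrite -(@lee_pmul2l _ C%:E) // ?lte_fin // -EFinM divff ?gt_eqF //.
  rewrite -nneseriesZl; last by move=> k _; exact: hcontrib_ge0.
  apply/lee_addgt0Pr => eps eps0.
  have cover k : exists I : set R, [/\ measurable I, F k `&` A `<=` I &
      (mu I <= C%:E * hcontrib d s (F k) + (eps / (2 ^ k.+1)%:R)%:E)%E].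
    have ek : 0 < eps / (2 ^ k.+1)%:R by rewrite divr_gt0 // ltr0n expn_gt0.
    have [->|/set0P FA] := eqVneq (F k `&` A) set0.
      exists set0; split=> //; rewrite measure0 adde_ge0 ?mule_ge0 ?hcontrib_ge0 ?lee_fin ?ltW //.
    have [x [y [q [q' [[Fx _] [Fy _] Fq Hq]]]]] := hull _ _ ek (@subIsetr _ _ _) FA.
    exists `[q, q'[%classic; split=> //.
    have mfin : mu `[q, q'[%classic \is a fin_num by exact: fin_num_measure.
    rewrite -(fineK mfin); apply: (@le_trans _ _ (C * d x y `^ s + eps / (2 ^ k.+1)%:R)%:E).
      by rewrite lee_fin.
    rewrite EFinD EFinM leeD2r // lee_pmul2l // ?lte_fin //.
    exact: hcontrib_ge.
  have [I HI] := choice cover.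
  rewrite -A1; apply: (@le_trans _ _ (\sum_(0 <= k <oo) mu (I k))%E).
    apply: measure_sigma_subadditive => //; first by move=> k; have [] := HI k.
    move=> x Ax; have [k _ Fx] := AF x Ax; exists k => //.
    by have [_ + _] := HI k; apply.
  apply: le_trans (epsilon_trick _ _ (ltW eps0)); last first.
    by move=> k; rewrite mule_ge0 ?hcontrib_ge0 // lee_fin ltW.
  by apply: lee_nneseries => [k _ _|k _]; [exact: measure_ge0|have [] := HI k].
by rewrite H0 lee_fin leNgt invr_gt0 C0.
Qed.

Lemma d_meas_ge0 (nu : probability R R) x y : 0 <= d_meas nu x y.
Proof. exact: fine_ge0. Qed.


Lemma d_measE (nu : probability R R) x y : 0 <= x -> 0 <= y ->
  d_meas nu x y = `|cdf0 nu y - cdf0 nu x|.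
Proof.
wlog xy : x y / x <= y => [H x0 y0|x0 _].
  have [/H->//|/ltW yx] := leP x y.
  by rewrite distrC -H // /d_meas minC maxC.
by rewrite /d_meas min_l // max_r // cdf0B ?x0 // ger0_norm // fine_ge0.
Qed.

Lemma hausdorff_delta_ge0 d s delta A : (0 <= hausdorff_delta d s delta A)%E.
Proof.
by apply/ereal_infP => _ [F _ <-]; apply: nneseries_ge0 => k _ _; exact: hcontrib_ge0.
Qed.

Lemma cdf0_itv (nu : probability R R) x : 0 <= cdf0 nu x <= 1.
Proof.
rewrite /cdf0 fine_ge0 //= -lee_fin fineK ?probability_le1 //.
exact: fin_num_measure.
Qed.

Lemma hausdorff_measure_unit (nu : probability R R) s : 1 < s ->
  hausdorff_measure (d_meas nu) s `[0, 1[%classic = 0%E.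
Proof.
move=> s1; pose e := s - 1; have e0 : 0 < e by rewrite subr_gt0.
apply/eqP; rewrite eq_le; apply/andP; split; last first.
  apply: (@le_trans _ _ (hausdorff_delta (d_meas nu) s 1 `[0, 1[%classic)).
    exact: hausdorff_delta_ge0.
  by apply: ereal_sup_ubound; exists 1 => //=.
apply: ge_ereal_sup => _ [delta /= delta0 <-].
apply/lee_addgt0Pr => eps eps0; rewrite add0e.
(* Chosen so that 1/N <= th gives 2 N^(-e) <= eps, where N + 1 pieces of diameter at most 1/N have
   total contribution (N+1) N^(-s) <= 2 N^(-e). *)
pose th := (eps / 2) `^ e^-1.
have th0 : 0 < th by rewrite powR_gt0 // divr_gt0.
have b0 : 0 <= delta^-1 + th^-1 by rewrite addr_ge0 // invr_ge0 ltW.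
have := archi_boundP b0; set N := Num.Def.archi_bound _ => bN.
have N0 : (0 : R) < N%:R by rewrite (le_lt_trans b0).
have dN : N%:R^-1 <= delta.
  rewrite invf_ple ?posrE //.
  by apply: le_trans (ltW bN); rewrite lerDl invr_ge0 ltW.
have tN : N%:R^-1 <= th.
  rewrite invf_ple ?posrE //.
  by apply: le_trans (ltW bN); rewrite lerDr invr_ge0 ltW.
(* Pullbacks of [k/N, (k+1)/N) under the distribution function. The index k = N takes the points
   where it equals 1; all later pieces are empty. *)
pose F k : set R := [set x : R | [/\ (k <= N)%N, 0 <= x < 1 &
                                k%:R / N%:R <= cdf0 nu x < k.+1%:R / N%:R]].
have Fd k x y : F k x -> F k y -> d_meas nu x y <= N%:R^-1.
  move=> [_ /andP[x0 _] xk] [_ /andP[y0 _] yk]; rewrite d_measE //.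
  move: xk yk; rewrite -[k.+1%:R]natr1 mulrDl mul1r ler_norml => xk yk.
  by apply/andP; split; lra.
have Fdiam k : (diam (d_meas nu) (F k) <= (N%:R^-1)%:E)%E.
  by apply: ge_ereal_sup => _ [[x y] [/= Fx Fy] <-]; rewrite lee_fin; exact: Fd Fx Fy.
have Fh k : (hcontrib (d_meas nu) s (F k) <= (N%:R^-1 `^ s)%:E)%E.
  rewrite /hcontrib; case: asboolP => [_|/eqP/set0P[x Fx]].
    by rewrite lee_fin powR_ge0.
  have fin : diam (d_meas nu) (F k) \is a fin_num.
    have := diam_ge (d_meas nu) Fx Fx; have := Fdiam k.
    by case: diam.
  rewrite lee_fin ge0_ler_powR //.
  - by rewrite ltW // (lt_trans _ s1).
  - rewrite nnegrE fine_ge0 // (le_trans _ (diam_ge (d_meas nu) Fx Fx)) //.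
    by rewrite lee_fin d_meas_ge0.
  - by rewrite nnegrE invr_ge0 ltW.
  - by rewrite -lee_fin fineK.
apply: (@le_trans _ _ (\sum_(0 <= k <oo) hcontrib (d_meas nu) s (F k))%E).
  apply: ereal_inf_lbound; exists F => //; split; last first.
    by move=> k; apply: le_trans (Fdiam k) _; rewrite lee_fin.
  move=> x /=; rewrite in_itv /= => x01.
  have /andP[G0 G1] := cdf0_itv nu x.
  have z0 : 0 <= cdf0 nu x * N%:R by rewrite mulr_ge0 // ltW.
  have [k /andP[zl zu]] : exists k, k%:R <= cdf0 nu x * N%:R < k.+1%:R.
    by eexists; exact: truncn_itv z0.
  exists k => //; split=> //.
    rewrite -(ler_nat R); apply: le_trans zl _.
    by rewrite -[leRHS]mul1r ler_wpM2r // ltW.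
  by rewrite ler_pdivrMr // ltr_pdivlMr // zl zu.
rewrite (nneseries_split 0 N.+1); last by move=> k _; exact: hcontrib_ge0.
rewrite [X in (_ + X)%E]eseries0 ?adde0; last first.
  move=> k Nk _; rewrite /hcontrib ifT //; apply/asboolP/seteqP; split=> // x [kN _ _].
  by move: Nk; rewrite add0n ltnNge kN.
apply: (@le_trans _ _ (\sum_(0 <= k < 0 + N.+1) (N%:R^-1 `^ s)%:E)%E).
  by apply: lee_sum => k _; exact: Fh.
rewrite sumEFin lee_fin sumr_const_nat add0n subn0 -[leLHS]mulr_natl.
have -> : s = 1 + e by rewrite /e addrC subrK.
rewrite powRD; last by apply/implyP => _; rewrite gt_eqF ?invr_gt0.
rewrite powRr1; last by rewrite invr_ge0 ltW.
rewrite mulrA.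
have -> : eps = 2 * (eps / 2) by rewrite mulrC divfK.
apply: ler_pM; rewrite ?powR_ge0 ?mulr_ge0 ?invr_ge0 ?ler0n //.
  rewrite ler_pdivrMr // -natr1.
  have : 1 <= N%:R :> R by rewrite ler1n -(ltr0n R).
  lra.
have -> : eps / 2 = th `^ e.
  by rewrite /th -powRrM mulVf ?gt_eqF // powRr1 // divr_ge0 // ltW.
by apply: ge0_ler_powR => //; rewrite ?nnegrE ?invr_ge0; exact: ltW.
Qed.

Lemma hausdorff_dim_meas_le1 (mu nu : probability R R) : mu `[0, 1[%classic = 1%E ->
  (hausdorff_dim_meas mu (d_meas nu) <= 1)%E.
Proof.
move=> mu1; apply: (@le_trans _ _ (hausdorff_dim (d_meas nu) `[0, 1[%classic)).
  apply: ereal_inf_lbound; exists `[0, 1[%classic => //; split; first exact: measurable_itv.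
  by split=> //; exact: subset_refl.
apply/lee_addgt0Pr => e e0; apply: ereal_inf_lbound; exists (1 + e) => //.
split; first by rewrite addr_ge0 // ltW.
by rewrite hausdorff_measure_unit // ltrDl.
Qed.

End Hausdorff.

(** * Conclusion *)

Section Limits.
Variable R : realType.
Variable p : nat.
Hypothesis p1 : (1 < p)%N.
Let L : R := ln p%:R.
Let L0 : 0 < L. Proof. by rewrite ln_gt0 // ltr1n. Qed.

Lemma quadratic_le (f : nat -> R) B B' : B <= B' -> quadratic p f B -> quadratic p f B'.
Proof.
move=> BB fB k; have /andP[lo hi] := fB k.
have : B * k.+1%:R <= B' * k.+1%:R by rewrite ler_wpM2r.
by move=> *; apply/andP; split; lra.
Qed.

(** Normalising by (k+1)^2 instead of k^2 keeps level 0 harmless: with u_k = 1/(k+1) one has k u_k =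
    1 - u_k, and the error B(k+1) becomes B u_k. *)
Lemma quadratic_cvg (f : nat -> R) B : quadratic p f B ->
  (fun k => f k * k.+1%:R^-1 ^+ 2) @ \oo --> L.
Proof.
move=> fB; pose u : nat -> R := @harmonic R.
have u0 : u @ \oo --> (0 : R) := cvg_harmonic.
have uE k : k%:R * u k = 1 - u k.
  by rewrite /u /= -[X in X * _](addrK 1) natr1 mulrBl mul1r divff ?pnatr_eq0.
have cv c : (fun k => L * (1 - u k) ^+ 2 + c * u k) @ \oo --> L.
  suff : (fun k => L * (1 - u k) ^+ 2 + c * u k) @ \oo --> L * (1 - 0) ^+ 2 + c * 0.
    by rewrite subr0 expr1n mulr1 mulr0 addr0.
  have cB : (fun k => 1 - u k) @ \oo --> (1 - 0 : R).
    by apply: cvgB; [exact: cvg_cst|exact: u0].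
  apply: cvgD; last by apply: cvgM; [exact: cvg_cst|exact: u0].
  apply: cvgM; first exact: cvg_cst.
  by under eq_fun do rewrite expr2; rewrite expr2; exact: cvgM.
apply: (squeeze_cvgr _ (cv (- B)) (cv B)); near=> k.
have uk : 0 < u k by rewrite /u /= invr_gt0 ltr0n.
have /andP[] := fB k; rewrite -/L -[k.+1%:R^-1]/(u k) => lo hi.
have E : B * k.+1%:R * u k ^+ 2 = B * u k.
  by rewrite expr2 mulrA -(mulrA B) [k.+1%:R * _]divff ?pnatr_eq0 // mulr1.
have E2 : L * k%:R ^+ 2 * u k ^+ 2 = L * (1 - u k) ^+ 2 by rewrite -mulrA -exprMn uE.
have u2 : 0 <= u k ^+ 2 by rewrite sqr_ge0.
have := ler_wpM2r u2 lo; have := ler_wpM2r u2 hi.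
by rewrite mulrBl !mulNr E E2 => *; apply/andP; split; lra.
Unshelve. all: by end_near. Qed.

Lemma quadratic_ratio_einf (f g : nat -> R) B : quadratic p f B -> quadratic p g B ->
  limn_einf (fun k => (f k / g k)%:E) = 1%E.
Proof.
move=> fB gB; suff cv : (fun k => (f k / g k)%:E) @ \oo --> 1%:E.
  by have [->] := cvg_limn_einf_sup cv.
apply: cvg_EFin; first by near=> k.
have <- : L / L = 1 by rewrite divff // gt_eqF.
have -> : fine \o (fun k => (f k / g k)%:E)
   = fun k => (f k * k.+1%:R^-1 ^+ 2) * (g k * k.+1%:R^-1 ^+ 2)^-1.
  apply/funext => k /=; rewrite invfM mulrACA divff ?mulr1 //.
apply: cvgM; first exact: quadratic_cvg fB.
by apply: cvgV; [rewrite gt_eqF|exact: quadratic_cvg gB].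
Unshelve. all: by end_near. Qed.

End Limits.

(** * Invariant measures of T: level masses and dimension bound *)

Section InvariantMeasure.
Variable R : realType.
Variables (m p c1 : nat) (ell : nat -> R).
Let n := m.*2.+2.
Hypothesis (p1 : (1 < p)%N) (c1pos : (0 < c1)%N).
Hypothesis ell_pos : forall r, (1 <= r <= n)%N -> 0 < ell r.
Hypothesis ell1 : \sum_(1 <= r < n.+1) ell r = 1.
Hypothesis path : has_path (T_state n ell) (blocks_upto n p c1).

Section OneMeasure.
Variable lam : probability R R.
Hypothesis lam1 : lam `[0, 1[%classic = 1%E.
Hypothesis lam_inv : forall A, measurable A -> lam (T_map n ell @^-1` A) = lam A.

Let G := cdf0 lam.

Lemma cdf0_pi_invariant : invariant_under (pi_top n) (pi_bot n) ell G.
Proof.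
have [ut tb lpos] := pi_wf ell_pos.
exact: cdf0_invariant ut tb lpos lam_inv.
Qed.

Lemma Iki_mass k r : (1 <= r <= n)%N ->
  fine (lam (Iki n p c1 ell k r)) = blk_mass m p c1 ell G k r.
Proof.
move=> rn; rewrite /Iki (stage_blk_len ell_pos path) /blk_mass /piece_mass /=.
have [ut tb lpos] := blk_wf ell_pos path k.
have rt : r \in pi_top n by rewrite mem_iota add1n ltnS.
have [s0 _] := start_bounds lpos (perm_refl _) rt.
rewrite cdf0B ?s0 ?lerDl ?ltW ?lpos //.
Qed.

Lemma Iki_quadratic : exists B, [/\ 0 <= B,
  forall r, (1 <= r <= n)%N -> quadratic p (fun k => ln (bki n p c1 k r)%:R : R) B,
  forall k r, (1 <= r <= n)%N -> 0 < blk_mass m p c1 ell G k r &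
  forall r, (1 <= r <= n)%N -> quadratic p (fun k => - ln (blk_mass m p c1 ell G k r)) B].
Proof.
have inv := cdf0_pi_invariant.
apply: quadratic_bounds => //.
- by move=> k r rn; rewrite -Iki_mass // fine_ge0.
- by move=> k r rn; exact: blk_massE.
- by move=> k; apply: blk_mass_norm => //; rewrite /G cdf01 // cdf00 subr0.
Qed.

End OneMeasure.

Section TwoMeasures.
Variables mu nu : probability R R.
Hypothesis (mu1 : mu `[0, 1[%classic = 1%E) (nu1 : nu `[0, 1[%classic = 1%E).
Hypothesis mu_inv : forall A, measurable A -> mu (T_map n ell @^-1` A) = mu A.
Hypothesis nu_inv : forall A, measurable A -> nu (T_map n ell @^-1` A) = nu A.

Let F := cdf0 mu.
Let G := cdf0 nu.
Let L : R := ln p%:R.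

(** One tiling [W] for both measures: floors are small for [mu] and not too small for [nu], with the
    same leading exponent. *)
Lemma level_bounds : exists B, 0 <= B /\ forall k, exists W,
  [/\ \sum_(a <- W) blk_len m p c1 ell k a = 1,
      forall a, a \in W -> 0 < blk_len m p c1 ell k a &
      forall U a V, W = U ++ a :: V -> let q := \sum_(b <- U) blk_len m p c1 ell k b in
        F (q + blk_len m p c1 ell k a) - F q <= expR (- L * k%:R ^+ 2 + B * k.+1%:R) /\
        expR (- L * k%:R ^+ 2 - B * k.+1%:R) <= G (q + blk_len m p c1 ell k a) - G q].
Proof.
have [B1 [B10 _ F0 FB]] := Iki_quadratic mu1 mu_inv.
have [B2 [B20 _ G0 GB]] := Iki_quadratic nu1 nu_inv.
exists (B1 + B2); split; first exact: addr_ge0.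
move=> k; have [W [W1 HW]] := blk_tiles ell_pos path k ell1.
have FW := HW _ (cdf0_pi_invariant mu_inv); have GW := HW _ (cdf0_pi_invariant nu_inv).
have [ut tb lpos] := blk_wf ell_pos path k.
have top U a V : W = U ++ a :: V -> a \in pi_top n.
  by move=> E; move: FW; rewrite E => /tiles_cat[].
exists W; split=> //.
  by move=> a /mem_split[U [V [E _]]]; apply/lpos/(top _ _ _ E).
move=> U a V E q; have an := top _ _ _ E.
have la : 0 <= blk_len m p c1 ell k a by exact/ltW/lpos.
have rn : (1 <= a <= n)%N by move: an; rewrite mem_iota; lia.
rewrite E in FW GW; rewrite (tiles_mass FW la) (tiles_mass GW la).
rewrite -/(blk_mass m p c1 ell F k a) -/(blk_mass m p c1 ell G k a).
have k0 : 0 <= k.+1%:R :> R by [].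
have := FB a rn k; have := GB a rn k.
rewrite -/F -/G -/L -{3}[blk_mass _ _ _ _ F k a]lnK ?posrE ?F0 //.
rewrite -{3}[blk_mass _ _ _ _ G k a]lnK ?posrE ?G0 // !ler_expR.
move=> /andP[g1 g2] /andP[f1 f2].
have := mulr_ge0 B10 k0; have := mulr_ge0 B20 k0.
by split; lra.
Qed.

Lemma hausdorff_dim_meas_ge1 : (1 <= hausdorff_dim_meas mu (d_meas nu))%E.
Proof.
have [B [B0 lev]] := level_bounds.
have L0 : 0 < L by rewrite ln_gt0 // ltr1n.
have Fle := @cdf0_le R mu; have Gle := @cdf0_le R nu.
apply/ereal_infP => _ [A [mA [A01 A1]] <-]; apply/ereal_infP => _ [s [s0 sA] <-].
rewrite lee_fin leNgt; apply/negP => s1.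
have [C C0 holder] : exists2 C, 0 < C & forall x y, 0 <= x <= y -> y <= 1 ->
    F y - F x <= C * (G y - G x) `^ s.
  apply: (@holder_of_levels R F G L B) => //; first by rewrite s0.
    move=> x y xy y1; have := Fle _ _ xy; have := Gle _ _ xy.
    have := cdf0_itv mu y; have := cdf0_itv mu x; rewrite -/F -/G => *.
    by split; lra.
  move=> k x y xy y1; have [W [W1 lpos HW]] := lev k.
  apply: (@level_dichotomy R F W (blk_len m p c1 ell k)) => //.
  - by move=> U a V E; have [] := HW U a V E.
  - by move=> U a V E; have [] := HW U a V E.
  - by rewrite W1.
apply: (hausdorff_measure_gt0 (mu := mu) s0 C0 _ mA A1 _ sA); first exact: d_meas_ge0.
(* The level is fine enough for the two floors added when [U] is widened to whole floors to have
   mass below eps together. *)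
move=> eps U eps0 UA U0; have [k kM] := level_mass_small L0 B0 eps0.
have [W [W1 lpos HW]] := lev k.
have [||x [y [q [q' [Ux Uy xy [qq' Uq Fq]]]]]] :=
  @level_hull R F W (blk_len m p c1 ell k) (expR (- L * k%:R ^+ 2 + B * k.+1%:R))
    Fle lpos _ U U0.
- by move=> V a V' E; have [] := HW V a V' E.
- by move=> z /UA/A01 /=; rewrite in_itv W1.
exists x, y, q, q'; split=> //.
rewrite -cdf0B //; apply: le_trans Fq _; apply: lerD; last exact: ltW.
have /andP[x0 xy'] := xy.
have y1 : y <= 1 by have := A01 _ (UA _ Uy); rewrite /= in_itv /= => /andP[_ /ltW].
rewrite d_measE // ?(le_trans x0) // ger0_norm ?subr_ge0 ?Gle //.
exact: holder.
Qed.

End TwoMeasures.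
End InvariantMeasure.

Theorem theorem2 (R : realType) (n p c1 : nat) (ell : nat -> R)
    (i j : nat) (lam_i lam_j : probability R R) :
  (4 <= n)%N -> ~~ odd n -> (n.+1 <= p)%N -> (0 < c1)%N ->
  (forall r, (1 <= r <= n)%N -> 0 < ell r) ->
  \sum_(1 <= r < n.+1) ell r = 1 ->
  has_path (T_state n ell) (blocks_upto n p c1) ->
  admissible n i -> admissible n j -> i != j ->
  is_lambda n p c1 ell i lam_i -> is_lambda n p c1 ell j lam_j ->
  let dj := d_meas lam_j in
  let logb (base x : R) := ln x / ln base in
  (limn_einf (fun k => (logb (fine (lam_j (Iki n p c1 ell k i)))
                            (fine (lam_i (Iki n p c1 ell k i))))%:E)
     <= hausdorff_dim_meas lam_i dj)%E /\
  (hausdorff_dim_meas lam_i dj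
     <= limn_einf (fun k => (logb (fine (lam_j (Iki n p c1 ell k i)))
                                  ((bki n p c1 k i)%:R)^-1)%:E))%E.
Proof.
move=> n4 evn np c1pos ell_pos ell1 path adi _ _ [lami1 lami_inv _] [lamj1 lamj_inv _] dj logb.
have p1 : (1 < p)%N by lia.
have i_n : (1 <= i <= n)%N by move: adi; rewrite /admissible; lia.
have nE : n = (n./2.-1).*2.+2 by lia.
move: (n./2.-1) nE => m nE; subst n.
have [B1 [B10 bB m0 mB]] := Iki_quadratic p1 c1pos ell_pos ell1 path lami1 lami_inv.
have [B2 [B20 _ n0 nB]] := Iki_quadratic p1 c1pos ell_pos ell1 path lamj1 lamj_inv.
have Q1 f : quadratic p f B1 -> quadratic p f (B1 + B2) by apply: quadratic_le; rewrite lerDl.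
have Q2 f : quadratic p f B2 -> quadratic p f (B1 + B2) by apply: quadratic_le; rewrite lerDr.
have E x y : logb x y = - ln y / - ln x by rewrite /logb invrN mulrNN.
split.
- under eq_fun do rewrite E !(Iki_mass ell_pos path _ _ i_n).
  rewrite (quadratic_ratio_einf p1 (Q1 _ (mB _ i_n)) (Q2 _ (nB _ i_n))).
  exact: (hausdorff_dim_meas_ge1 p1 c1pos ell_pos ell1 path).
- under eq_fun => k.
    rewrite E !(Iki_mass ell_pos path _ _ i_n) lnV ?opprK; last first.
      by rewrite posrE ltr0n bki_gt0.
    over.
  rewrite (quadratic_ratio_einf p1 (Q1 _ (bB _ i_n)) (Q2 _ (nB _ i_n))).
  exact: hausdorff_dim_meas_le1.
Qed.
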